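(* Let $D$ be a division ring with center $F$ and let $N$ be a non-abelian almost subnormal subgroup of $D^*$. If there is a positive integer $d$ such that $xyx^{-1}y^{-1}$ is algebraic over $F$ of degree at most $d$ for all $x,y\in N$, then $D$ is centrally finite.
   Context: $D^*$ is the multiplicative group of $D$. $D$ is centrally finite if it is a finite-dimensional vector space over its center $F$. A subgroup $N$ of a group $G$ is almost subnormal in $G$ if there is a finite series of subgroups $N=N_r\le N_{r-1}\le\cdots\le N_0=G$ such that for each $1\le i\le r$, either $N_i$ is normal in $N_{i-1}$ or $N_i$ has finite index in $N_{i-1}$. *)

(* Defs.v *)
From HB Require Import structures.
From mathcomp Require Import all_boot all_order all_algebra.
From mathcomp Require Import boolp classical_sets cardinality.
Set Implicit Arguments.
Unset Strict Implicit.
Unset Printing Implicit Defensive.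
Import GRing.Theory.
Local Open Scope classical_set_scope.
Local Open Scope ring_scope.

(* The library's {unit R} is available for finite rings only. *)
Record units (R : unitRingType) :=
  Units { unit_val :> R; unit_valP : unit_val \is a GRing.unit }.

Section UnitsGroup.
Variable R : unitRingType.
Implicit Types u v : units R.

HB.instance Definition _ := [isSub of units R for @unit_val R].
HB.instance Definition _ := [Choice of units R by <:].

Fact units_inv_subproof u : (val u)^-1 \is a GRing.unit.
Proof. by rewrite unitrV (valP u). Qed.

Fact units_mul_subproof u v : val u * val v \is a GRing.unit.
Proof. by rewrite (unitrMr _ (valP u)) (valP v). Qed.

Definition units_one : units R := Units (@unitr1 R).
Definition units_inv u : units R := Units (units_inv_subproof u).
Definition units_mul u v : units R := Units (units_mul_subproof u v).

Fact units_mulA : associative units_mul.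
Proof. by move=> u v w; apply/val_inj/mulrA. Qed.
Fact units_mul1 : left_id units_one units_mul.
Proof. by move=> u; apply/val_inj/mul1r. Qed.
Fact units_mulr1 : right_id units_one units_mul.
Proof. by move=> u; apply/val_inj/mulr1. Qed.
Fact units_mulV : left_inverse units_one units_inv units_mul.
Proof. by move=> u; apply/val_inj/(mulVr (valP u)). Qed.
Fact units_mulrV : right_inverse units_one units_inv units_mul.
Proof. by move=> u; apply/val_inj/(mulrV (valP u)). Qed.

HB.instance Definition _ := isGroup.Build (units R)
  units_mulA units_mul1 units_mulr1 units_mulV units_mulrV.

End UnitsGroup.

Section AlmostSubnormal.
Local Open Scope group_scope.
Variable G : groupType.
Implicit Types H K N : set G.

Definition subgroup H := group_closed (mem H).

Definition normal_in N H :=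
  N `<=` H /\ forall x y, N x -> H y -> N (x ^ y).

Definition finite_index_in K H :=
  K `<=` H /\ finite_set [set [set x * y | y in K] | x in H].

(* S 0, ..., S r is the series N_0, ..., N_r; the values S i for i > r are
   irrelevant. *)
Definition almost_subnormal N :=
  exists (r : nat) (S : nat -> set G),
    [/\ S 0%N = [set: G], S r = N,
        forall i, (i <= r)%N -> subgroup (S i)
      & forall i, (i < r)%N ->
          S i.+1 `<=` S i /\
          (normal_in (S i.+1) (S i) \/ finite_index_in (S i.+1) (S i))].

Definition abelian_set N := forall x y, N x -> N y -> commute x y.

End AlmostSubnormal.

Definition division_ring (D : unitRingType) := GRing.field_axiom D.

Section CentralAlgebra.
Variable F : fieldType.

(* F is identified with its image under the scalar embedding c |-> c%:A. *)
Definition has_center (D : algType F) :=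
  forall z : D, (forall y, z * y = y * z) <-> exists c : F, z = c%:A.

Definition minimal_polynomial (D : algType F) (a : D) (p : {poly F}) :=
  [/\ p \is monic, horner_alg a p = 0
    & forall q : {poly F}, q != 0 -> horner_alg a q = 0 ->
        (size p <= size q)%N].

Definition algebraic_of_degree (D : algType F) (a : D) (n : nat) :=
  exists2 p : {poly F}, minimal_polynomial a p & size p = n.+1.

Definition finite_dimensional (V : lmodType F) :=
  exists n : nat, inhabited (Vector.axiom n V).

End CentralAlgebra.

(* Main.v *)
Require Import Defs.
From HB Require Import structures.
From mathcomp Require Import all_boot all_order all_algebra.
From mathcomp Require Import finfield.
From mathcomp Require Import boolp classical_sets cardinality.

(* Suppose that D has infinite dimension over F.

   F infinite.  Follow the series from D^* down to N with rational curves
   1 + t v + ...: commutation with a normalised element a replaces v by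
   v - a v a^-1, and at a step of finite index the pigeonhole principle yields a
   quotient of two curves, with parameter a scalar multiple of v.  So N contains
   curves whose first order terms are T(y), y in D, with T a composite of the
   operators v |-> v - a v a^-1.  An operator y |-> \sum_k p_k y q_k of finite
   rank is zero; by induction along the series this implies that only F commutes
   with all these first order terms, hence that nonzero T exist at every level.
   One more commutator shows that every T(y) is algebraic of degree at most d.
   Cramer's rule turns this into \sum_(j <= m) c_j(y) T(y)^j = 0 with scalar
   polynomial functions c_j, and differentiating it in y forces c_m = 0.

   F finite.  Commutators of elements of N now have an order e prime to the
   characteristic.  There are a in N and y with a y = g y a, g <> 1 and a g = g a,
   where a or y has infinite order by Wedderburn's theorem; a power u of it
   commutes with a and y.  The curves above in the centralizer of u, with
   parameter in the powers of u, give commutators 1 + t c (1 - g)^k y + ... of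
   order e, although e c (1 - g)^k y <> 0. *)

Set Implicit Arguments.
Unset Strict Implicit.
Unset Printing Implicit Defensive.
Import GRing.Theory.
Local Open Scope classical_set_scope.
Local Open Scope ring_scope.

(** * Linear algebra over a field *)

Section LinearAlgebra.
Variables (F : fieldType) (V : lmodType F).
Implicit Types (s : seq V) (x u v : V) (U : set V).

Inductive lspan s : set V :=
| lspan0 : lspan s 0
| lspan_cons c v u : v \in s -> lspan s u -> lspan s (c *: v + u).

Lemma lspan_mem s v : v \in s -> lspan s v.
Proof. by move=> vs; have := lspan_cons 1 vs (lspan0 s); rewrite scale1r addr0. Qed.

Lemma lspanD s u v : lspan s u -> lspan s v -> lspan s (u + v).
Proof.
move=> su sv; elim: su => [|c w z ws _ IH]; first by rewrite add0r.
by rewrite -addrA; apply: lspan_cons.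
Qed.

Lemma lspanZ s c u : lspan s u -> lspan s (c *: u).
Proof.
elim=> [|d w z ws _ IH]; first by rewrite scaler0; exact: lspan0.
by rewrite scalerDr scalerA; apply: lspan_cons.
Qed.

Lemma lspanB s u v : lspan s u -> lspan s v -> lspan s (u - v).
Proof. by move=> su sv; rewrite -scaleN1r; apply/lspanD/lspanZ. Qed.

Lemma lspan_sum s (I : Type) (r : seq I) (P : pred I) (f : I -> V) :
  (forall i, P i -> lspan s (f i)) -> lspan s (\sum_(i <- r | P i) f i).
Proof. by move=> h; elim/big_rec: _ => [|i y /h]; [exact: lspan0 | exact: lspanD]. Qed.

Lemma lspan_trans s t u : (forall v, v \in s -> lspan t v) -> lspan s u -> lspan t u.
Proof.
move=> st; elim=> [|c v w /st tv _ IH]; first exact: lspan0.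
exact/lspanD/IH/lspanZ.
Qed.

Lemma lspan_sub s t u : {subset s <= t} -> lspan s u -> lspan t u.
Proof. by move=> st; apply: lspan_trans => v /st/lspan_mem. Qed.

Definition finite_rank U := exists s, U `<=` lspan s.

(** By Zorn's lemma choose [A] maximal among the sets closed under [c *: u + v] with [x] outside
    [A + lspan s]. Maximality makes [A] a hyperplane containing [lspan s] and complementary to the
    line of [x]; [f] is the coordinate along [x] modulo [A]. *)
Lemma separating_functional s x : ~ lspan s x ->
  exists f : {scalar V}, f x = 1 /\ forall v, lspan s v -> f v = 0.
Proof.
move=> nsx.
pose closed (W : set V) := forall c u v, W u -> W v -> W (c *: u + v).
(* [P] holds of the empty set, the union of the empty chain; this is why [w = 0] is treated apart in
   [B] below. *)
pose P (W : set V) := closed W /\ forall w z, W w -> lspan s z -> x <> w + z.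
have [A [[Acl Ax] Amax]] : exists A, P A /\ forall B, A `<` B -> ~ P B.
  apply: Zorn_bigcup => /= Fs FsP Ftot; split=> [c u v [X FX Xu] [Y FY Yv]|].
    have [XY|YX] := Ftot _ _ FX FY.
      by exists Y => //; apply: (FsP _ FY).1 => //; apply: XY.
    by exists X => //; apply: (FsP _ FX).1 => //; apply: YX.
  by move=> w z [X FX Xw]; apply: (FsP _ FX).2.
have Bmax B : A `<=` B -> P B -> B `<=` A.
  by move=> AB PB; apply: contrapT => nBA; apply: (Amax B).
have sA : lspan s `<=` A.
  pose B v := exists w z, [/\ A w \/ w = 0, lspan s z & v = w + z].
  have AB : A `<=` B.
    by move=> v Av; exists v, 0; rewrite addr0; split=> //; [left | exact: lspan0].
  have PB : P B.
    split=> [c u v [w [z [hw hz ->]]] [w' [z' [hw' hz' ->]]]|].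
      exists (c *: w + w'), (c *: z + z'); split.
      - case: hw => [hw|->]; case: hw' => [hw'|->]; rewrite ?scaler0 ?add0r.
        + by left; apply: Acl.
        + have A0: A 0 by have := Acl (-1) _ _ hw hw; rewrite scaleN1r addNr.
          by left; apply: Acl.
        + by left.
        + by right.
      - exact/lspanD/hz'/lspanZ.
      - by rewrite scalerDr addrACA.
    move=> _ z' [w [z [hw hz ->]]] hz' xE.
    case: hw => [hw|w0]; first by apply: (Ax w (z + z')); rewrite ?addrA//; exact: lspanD.
    by apply: nsx; rewrite xE w0 add0r; apply: lspanD.
  move=> v sv; apply: (Bmax B AB PB); exists 0, v; rewrite add0r.
  by split => //; right.
have A0 : A 0 by apply: sA; exact: lspan0.
have AD u v : A u -> A v -> A (u + v) by move=> /(Acl 1) /[apply]; rewrite scale1r.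
have AZ c u : A u -> A (c *: u) by move=> /(Acl c) /(_ A0); rewrite addr0.
have nAx : ~ A x by move=> hx; apply: (Ax x 0) => //; [exact: lspan0 | rewrite addr0].
(* If no [v - c *: x] lay in [A], then [A + F v] would still satisfy [P], so [v] would lie in [A] by
   maximality and [c = 0] would do. *)
have proj v : {c | A (v - c *: x)}.
  apply: cid; apply: contrapT => nv.
  pose B u := exists c, A (u - c *: v).
  have Av : A v.
    apply: (Bmax B).
    - by move=> u Au; exists 0; rewrite scale0r subr0.
    - split=> [c u w [d hd] [e he]|].
        exists (c * d + e); rewrite scalerDl opprD addrACA -scalerA -scalerBr.
        exact: Acl.
      move=> u z [c Au] sz xE; apply: nv.
      have Axc : A (x - c *: v) by rewrite xE addrAC; apply: AD => //; exact: sA.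
      have [c0|c0] := eqVneq c 0.
        by case: nAx; move: Axc; rewrite c0 scale0r subr0.
      exists c^-1; have := AZ (- c^-1) _ Axc.
      by rewrite scalerBr scalerA mulNr mulVf// scaleN1r opprK addrC scaleNr.
    - by exists 1; rewrite scale1r subrr.
  by apply: nv; exists 0; rewrite scale0r subr0.
pose f v := sval (proj v).
have fP v c : A (v - c *: x) -> f v = c.
  move=> Ac; have Af : A (v - f v *: x) := svalP (proj v).
  apply/eqP; rewrite -subr_eq0; apply/eqP; apply: contrapT => /eqP nz.
  apply: nAx; have := AD _ _ Ac (AZ (-1) _ Af).
  rewrite scaleN1r opprB addrC addrA subrK -scalerBl.
  by move=> /(AZ (f v - c)^-1); rewrite scalerA mulVf// scale1r.
have fl : scalar f.
  move=> c u v; apply: fP; rewrite scalerDl -scalerA opprD addrACA -scalerBr.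
  by apply: AD; [apply: AZ|]; exact: (svalP (proj _)).
pose m := GRing.isLinear.Build F V F *%R f fl.
exists (HB.pack f m : {scalar V}); split=> /=.
  by apply: fP; rewrite scale1r subrr.
by move=> v sv; apply: fP; rewrite scale0r subr0; apply: sA.
Qed.

Lemma functional0 x : (forall f : {scalar V}, f x = 0) -> x = 0.
Proof.
move=> h; apply: contrapT => /eqP x0.
have [|f [fx _]] := @separating_functional [::] x.
  by move=> sx; case: sx x0 => [|//]; rewrite eqxx.
by have := h f; rewrite fx; apply/eqP/oner_neq0.
Qed.

Definition free_family n (v : nat -> V) :=
  forall c : nat -> F, \sum_(i < n) c i *: v i = 0 -> forall i, (i < n)%N -> c i = 0.

Lemma lspan_free_family n (v : nat -> V) x :
  lspan [seq v i | i <- iota 0 n] x -> exists c : nat -> F, x = \sum_(i < n) c i *: v i.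
Proof.
elim=> [|d w y /mapP[i]]; first by exists (fun=> 0); rewrite big1// => *; rewrite scale0r.
rewrite mem_iota add0n => /andP[_ ilt] -> _ [c ->].
exists (fun j => (if j == i then d else 0) + c j).
under [RHS]eq_bigr do rewrite scalerDl.
rewrite big_split/=; congr (_ + _).
rewrite (bigD1 (Ordinal ilt))//= eqxx big1 ?addr0// => j jn.
by rewrite -val_eqE/= in jn; rewrite (negbTE jn) scale0r.
Qed.

Lemma lspan_free_familyP n (v : nat -> V) (c : nat -> F) :
  lspan [seq v i | i <- iota 0 n] (\sum_(i < n) c i *: v i).
Proof.
apply: lspan_sum => i _; apply/lspanZ/lspan_mem/mapP; exists (val i) => //.
by rewrite mem_iota/= add0n.
Qed.

(** Freeness keeps [v k] out of the span of the other members, so a functional separates it from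
    that span. *)
Lemma free_family_dual n (v : nat -> V) k : free_family n v -> (k < n)%N ->
  exists f : {scalar V}, forall i, (i < n)%N -> f (v i) = (i == k)%:R.
Proof.
move=> fr kn; pose s := [seq v i | i <- iota 0 n & i != k].
have spc x : lspan s x -> exists2 c : nat -> F, c k = 0 & x = \sum_(i < n) c i *: v i.
  elim=> [|d w y /mapP[i]].
    by exists (fun=> 0); rewrite // big1// => *; rewrite scale0r.
  rewrite mem_filter mem_iota add0n => /and3P[ik _ ilt] -> _ [c ck ->].
  exists (fun j => (if j == i then d else 0) + c j).
    by rewrite eq_sym (negbTE ik) ck addr0.
  under [RHS]eq_bigr do rewrite scalerDl.
  rewrite big_split/=; congr (_ + _).
  rewrite (bigD1 (Ordinal ilt))//= eqxx big1 ?addr0// => j jn.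
  by rewrite -val_eqE/= in jn; rewrite (negbTE jn) scale0r.
have [|f [fk f0]] := @separating_functional s (v k).
  move=> /spc[c ck vE]; have := fr (fun j => c j - (j == k)%:R).
  under eq_bigr do rewrite scalerBl.
  rewrite sumrB -vE (bigD1 (Ordinal kn))//= eqxx scale1r big1 => [|j].
    rewrite addr0 subrr => /(_ erefl k kn)/eqP.
    by rewrite ck eqxx sub0r oppr_eq0 oner_eq0.
  by rewrite -val_eqE/= => /negbTE->; rewrite scale0r.
exists f => i ilt; have [->//|ik] := eqVneq i k.
apply/f0/lspan_mem/mapP; exists i => //.
by rewrite mem_filter ik mem_iota add0n.
Qed.

Lemma free_familyS n (v : nat -> V) : free_family n v ->
  ~ lspan [seq v i | i <- iota 0 n] (v n) -> free_family n.+1 v.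
Proof.
move=> fr nsp c; rewrite big_ord_recr/= => /eqP cE.
have [cn|cn] := eqVneq (c n) 0.
  move=> i; rewrite ltnS leq_eqVlt => /orP[/eqP->//|]; apply: fr.
  by move: cE; rewrite cn scale0r addr0 => /eqP.
case: nsp; rewrite -[v n]scale1r -(mulVf cn) -scalerA.
rewrite addrC addr_eq0 in cE; rewrite (eqP cE) -scaleN1r scalerA.
exact/lspanZ/lspan_free_familyP.
Qed.

Lemma eq_free_family n (v w : nat -> V) : (forall i, (i < n)%N -> v i = w i) ->
  free_family n v -> free_family n w.
Proof.
by move=> e fr c h; apply: fr; apply: etrans h; apply: eq_bigr => i _; rewrite e.
Qed.

(** Each new vector either lies in the span of the free family found so far or extends it. This
    serves to rewrite sums of [p k * y * q k] with free right factors. *)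
Lemma extract_free_family n (q : nat -> V) :
  exists r b (c : nat -> nat -> F), free_family r b /\
    forall k, (k < n)%N -> q k = \sum_(j < r) c k j *: b j.
Proof.
elim: n => [|n [r [b [c [fr qE]]]]].
  by exists 0, (fun=> 0), (fun _ _ => 0); split=> // c _ i; rewrite ltn0.
have [sp|nsp] := pselect (lspan [seq b i | i <- iota 0 r] (q n)).
  have [d dE] := lspan_free_family sp.
  exists r, b, (fun k => if k == n then d else c k); split=> // k.
  by rewrite ltnS leq_eqVlt => /orP[/eqP->|kn]; rewrite ?eqxx// ltn_eqF// qE.
pose b' i := if i == r then q n else b i.
have b'E i : (i < r)%N -> b' i = b i by move=> h; rewrite /b' ltn_eqF.
exists r.+1, b', (fun k j => if k == n then (j == r)%:R else if j == r then 0 else c k j).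
split=> [|k].
  apply: free_familyS; first by apply: (eq_free_family _ fr) => i /b'E.
  rewrite {2}/b' eqxx; congr (~ lspan _ _): nsp; apply/eq_in_map => i.
  by rewrite mem_iota add0n => /andP[_ /b'E].
rewrite ltnS leq_eqVlt big_ord_recr/= => /orP[/eqP->|kn].
  rewrite !eqxx big1 => [|i _]; last by rewrite ltn_eqF// scale0r.
  by rewrite /b' eqxx scale1r add0r.
rewrite ltn_eqF// eqxx scale0r addr0 qE//; apply: eq_bigr => i _.
by rewrite b'E// ltn_eqF.
Qed.

Lemma finite_rank_dimensional : finite_rank [set: V] -> finite_dimensional V.
Proof.
move=> [s sP]; have [r [b [c [fr bE]]]] := extract_free_family (size s) (nth 0 s).
have coord v : {d : 'rV[F]_r | v = \sum_(i < r) d 0 i *: b i}.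
  apply: cid.
  have /lspan_free_family[d ->] : lspan [seq b i | i <- iota 0 r] v.
    apply: lspan_trans (sP v I) => w /(nthP 0)[i si <-].
    by rewrite bE//; exact: lspan_free_familyP.
  by exists (\row_i d i); apply: eq_bigr => i _; rewrite mxE.
have uniq (d e : 'rV[F]_r) :
    \sum_(i < r) d 0 i *: b i = \sum_(i < r) e 0 i *: b i -> d = e.
  move=> de; apply/rowP => i.
  have := fr (fun j => oapp (fun k => d 0 k - e 0 k) 0 (insub j : option 'I_r)) _ i (ltn_ord i).
  rewrite valK/= => h; apply/eqP; rewrite -subr_eq0; apply/eqP/h.
  under eq_bigr do rewrite valK/= scalerBl.
  by rewrite sumrB de subrr.
exists r; constructor; exists (fun v => sval (coord v)).
  move=> a u v; apply: uniq; rewrite -(svalP (coord _)).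
  under eq_bigr do rewrite !mxE scalerDl -scalerA.
  by rewrite big_split/= -scaler_sumr -!(svalP (coord _)).
exists (fun d : 'rV[F]_r => \sum_(i < r) d 0 i *: b i) => [v|d].
  by rewrite -(svalP (coord v)).
by apply: uniq; rewrite -(svalP (coord _)).
Qed.

End LinearAlgebra.

(** * Operators [y |-> \sum_k p_k y q_k] on a division algebra *)

Section DivisionRing.
Variables (R : unitRingType) (hR : division_ring R).
Implicit Types x y : R.

Lemma divring_mulf_eq0 x y : (x * y == 0) = (x == 0) || (y == 0).
Proof.
have [->|x0] := eqVneq x 0; first by rewrite mul0r eqxx.
have [->|y0] := eqVneq y 0; first by rewrite mulr0 eqxx.
by apply/eqP => xy0; move: y0; rewrite -[y](mulKr (hR x0)) xy0 mulr0 eqxx.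
Qed.

Lemma divring_mulf_neq0 x y : x != 0 -> y != 0 -> x * y != 0.
Proof. by rewrite divring_mulf_eq0 negb_or => -> ->. Qed.

Lemma divring_conj_fix x y : x != 0 -> (x * y * x^-1 = y) <-> x * y = y * x.
Proof.
move=> /hR xu; split=> [h|->]; last by rewrite mulrK.
by rewrite -{2}h mulrVK.
Qed.

End DivisionRing.

Section MultiplicationOperators.
Variables (F : fieldType) (D : unitAlgType F).
Hypotheses (hD : division_ring D) (hF : has_center D).
Hypothesis infD : ~ finite_rank [set: D].
Implicit Types (p q : nat -> D) (x y z : D) (s : seq D).

Lemma lspan_linear s (f : D -> D) x : linear f -> lspan s x -> lspan (map f s) (f x).
Proof.
move=> fl; have f0 : f 0 = 0.
  by have /eqP := fl 1 0 0; rewrite !scale1r addr0 -[X in X == _]addr0 (inj_eq (addrI _)) eq_sym => /eqP.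
elim=> [|c v u vs _ IH]; first by rewrite f0; exact: lspan0.
by rewrite fl; apply: lspan_cons => //; apply: map_f.
Qed.

Lemma lspan_mull s z x : lspan s x -> lspan [seq z * v | v <- s] (z * x).
Proof. by apply: lspan_linear => c u v; rewrite mulrDr scalerAr. Qed.

(** Induction on [n]. If [p n] is not 0, normalise it to 1 and write X for the operator. Then y |->
    X (z y) - z X y has finite rank and only the [n] coefficients [r k * z - z * r k], so every
    [r k] is central. Hence X is right multiplication by a combination [w] of the [q k], nonzero by
    freeness; being onto, it would make [D] finite-dimensional. *)
Lemma free_family_finite_rank_eq0 n p q s : free_family n q ->
  (forall y, lspan s (\sum_(k < n) p k * y * q k)) -> forall k, (k < n)%N -> p k = 0.
Proof.
elim: n p s => [//|n IH] p s fr sX.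
have frn : free_family n q.
  move=> c h i iln; have := fr (fun j => if j == n then 0 else c j).
  rewrite big_ord_recr/= eqxx scale0r addr0.
  under eq_bigr => j _ do rewrite ltn_eqF//.
  by move=> /(_ h i); rewrite ltn_eqF// ltnS (ltnW iln); apply.
have [pn0|pn0] := eqVneq (p n) 0.
  move=> k; rewrite ltnS leq_eqVlt => /orP[/eqP->//|]; apply: (IH _ s frn) => y.
  by have := sX y; rewrite big_ord_recr/= pn0 !mul0r addr0.
have pu := hD pn0; pose r k := (p n)^-1 * p k.
have rX y : lspan [seq (p n)^-1 * v | v <- s] (\sum_(k < n) r k * y * q k + y * q n).
  have := lspan_mull (p n)^-1 (sX y); rewrite big_ord_recr/= mulrDr mulr_sumr.
  rewrite -!mulrA mulKr//; congr (lspan _ (_ + _)).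
  by apply: eq_bigr => k _; rewrite !mulrA.
have rc k : (k < n)%N -> exists c : F, r k = c%:A.
  move=> kn; apply/(hF (r k)).1 => z; apply/eqP; rewrite -subr_eq0; apply/eqP.
  set s' := [seq (p n)^-1 * v | v <- s] in rX.
  apply: (IH (fun k => r k * z - z * r k) (s' ++ [seq z * v | v <- s']) frn _ _ kn) => y.
  have -> : \sum_(k < n) (r k * z - z * r k) * y * q k =
    (\sum_(k < n) r k * (z * y) * q k + z * y * q n)
      - z * (\sum_(k < n) r k * y * q k + y * q n).
    rewrite mulrDr -!mulrA opprD addrACA subrr addr0 mulr_sumr -sumrB.
    by apply: eq_bigr => i _; rewrite !mulrBl !mulrA.
  apply: lspanB.
    by apply: lspan_sub (rX _) => v; rewrite mem_cat => ->.
  by apply: lspan_sub (lspan_mull z (rX y)) => v; rewrite mem_cat => ->; rewrite orbT.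
have [c cE] : exists c : nat -> F, forall k, (k < n)%N -> r k = (c k)%:A.
  have /choice[c cE] : forall k, exists d : F, (k < n)%N -> r k = d%:A.
    move=> k; have [kn|kn] := boolP (k < n)%N; last by exists 0.
    by have [d dE] := rc k kn; exists d.
  by exists c.
pose w := \sum_(k < n) c k *: q k + q n.
have w0 : w != 0.
  apply/eqP => w0; have := fr (fun k => if k == n then 1 else c k).
  rewrite big_ord_recr/= eqxx scale1r.
  under eq_bigr => j _ do rewrite ltn_eqF//.
  by move=> /(_ w0 n (ltnSn n)); rewrite eqxx; apply/eqP/oner_neq0.
case: infD; exists [seq (p n)^-1 * v | v <- s] => x _.
have := rX (x * w^-1).
congr lspan; rewrite -[RHS](mulrVK (hD w0)) /w mulrDr mulr_sumr; congr (_ + _).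
by apply: eq_bigr => k _; rewrite cE// -!scalerAl mul1r -scalerAr.
Qed.

(* The tensor [\sum_k p_k (x) q_k] of an operator of finite rank vanishes: this
   is tested on linear functionals of the second factor. *)
Lemma finite_rank_functional n p q s :
  (forall y, lspan s (\sum_(k < n) p k * y * q k)) ->
  forall f : {scalar D}, \sum_(k < n) f (q k) *: p k = 0.
Proof.
move=> sX f; have [r [b [c [fr qE]]]] := extract_free_family n q.
pose P j := \sum_(k < n) c k j *: p k.
have P0 j : (j < r)%N -> P j = 0.
  apply: (free_family_finite_rank_eq0 fr (s := s)) => y.
  have := sX y; congr lspan.
  under eq_bigr => k _ do rewrite qE// mulr_sumr.
  rewrite exchange_big/=; apply: eq_bigr => i _; rewrite !mulr_suml.
  by apply: eq_bigr => k _; rewrite -!scalerAl -scalerAr.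
under eq_bigr => k _ do rewrite qE// linear_sum scaler_suml.
rewrite exchange_big big1// => j _.
under eq_bigr => k _ do rewrite linearZ/= mulrC -scalerA.
by rewrite -scaler_sumr -/(P j) P0// scaler0.
Qed.

Definition mulop (f : D -> D) :=
  exists n p q, forall y, f y = \sum_(k < n) p k * y * q k.

Lemma mulop_id : mulop id.
Proof.
by exists 1%N, (fun=> 1), (fun=> 1) => y; rewrite big_ord1 mul1r mulr1.
Qed.

Lemma mulop_lr f a b : mulop f -> mulop (fun y => a * f y * b).
Proof.
move=> [n [p [q fE]]]; exists n, (fun k => a * p k), (fun k => q k * b) => y.
by rewrite fE mulr_sumr mulr_suml; apply: eq_bigr => k _; rewrite !mulrA.
Qed.

Lemma mulopD f g : mulop f -> mulop g -> mulop (fun y => f y + g y).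
Proof.
move=> [n [p [q fE]]] [m [p' [q' gE]]].
exists (n + m)%N, (fun k => if (k < n)%N then p k else p' (k - n)%N),
  (fun k => if (k < n)%N then q k else q' (k - n)%N) => y.
rewrite fE gE big_split_ord/=; congr (_ + _); apply: eq_bigr => k _.
  by rewrite ltn_ord.
by rewrite ltnNge leq_addr/= addKn.
Qed.

Lemma mulopN f : mulop f -> mulop (fun y => - f y).
Proof.
move=> [n [p [q fE]]]; exists n, (fun k => - p k), q => y.
by rewrite fE -sumrN; apply: eq_bigr => k _; rewrite !mulNr.
Qed.

Lemma mulop_finite_rank_eq0 f s : mulop f -> (forall y, lspan s (f y)) ->
  forall y, f y = 0.
Proof.
move=> [n [p [q fE]]] sf y; have [r [b [c [fr qE]]]] := extract_free_family n q.
have fE' z : f z = \sum_(j < r) (\sum_(k < n) c k j *: p k) * z * b j.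
  rewrite fE; under eq_bigr => k _ do rewrite qE// mulr_sumr.
  rewrite exchange_big/=; apply: eq_bigr => j _; rewrite !mulr_suml.
  by apply: eq_bigr => k _; rewrite -!scalerAl -scalerAr.
rewrite fE' big1// => j _.
have := free_family_finite_rank_eq0 (p := fun j => \sum_(k < n) c k j *: p k) (s := s) fr.
by move=> ->; rewrite ?mul0r// => z; rewrite -fE'.
Qed.

Lemma mulop_free f : mulop f -> (exists y, f y <> 0) ->
  exists n p q k0, [/\ (forall y, f y = \sum_(k < n) p k * y * q k),
    free_family n q, (k0 < n)%N & p k0 != 0].
Proof.
move=> [n [p [q fE]]] [y fy]; have [r [b [c [fr qE]]]] := extract_free_family n q.
have fE' z : f z = \sum_(j < r) (\sum_(k < n) c k j *: p k) * z * b j.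
  rewrite fE; under eq_bigr => k _ do rewrite qE// mulr_sumr.
  rewrite exchange_big/=; apply: eq_bigr => j _; rewrite !mulr_suml.
  by apply: eq_bigr => k _; rewrite -!scalerAl -scalerAr.
have [k0 k0r pk0] : exists2 k0, (k0 < r)%N & \sum_(k < n) c k k0 *: p k != 0.
  apply: contrapT => nk; apply: fy; rewrite fE' big1// => j _.
  have [->|jn] := eqVneq (\sum_(k < n) c k j *: p k) 0; first by rewrite !mul0r.
  by case: nk; exists j.
by exists r, (fun j => \sum_(k < n) c k j *: p k), b, k0.
Qed.

(** The operator y |-> e f(y) - f(y) e vanishes, hence so does its tensor, written below with
    [n + n] terms. Testing the second factor on the functional dual to [q k0] expresses [e * p k0]
    through the [p k]. *)
Lemma centralizer_image_finite_rank f : mulop f -> (exists y, f y <> 0) ->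
  finite_rank [set e | forall y, e * f y = f y * e].
Proof.
move=> fM f0; have [n [p [q [k0 [fE fr k0n pk0]]]]] := mulop_free fM f0.
have [l lE] := free_family_dual fr k0n.
exists [seq p k * (p k0)^-1 | k <- iota 0 n] => e he.
have h0 : forall y, lspan [::]
    (\sum_(k < n + n) (if (k < n)%N then e * p k else - p (k - n)%N) * y *
                      (if (k < n)%N then q k else q (k - n)%N * e)).
  move=> y; rewrite big_split_ord/=.
  under eq_bigr => k _ do rewrite ltn_ord.
  under [X in _ + X]eq_bigr => k _ do rewrite ltnNge leq_addr/= addKn.
  have -> : \sum_(k < n) e * p k * y * q k + \sum_(k < n) - p k * y * (q k * e) = 0.
    have := he y; rewrite fE mulr_sumr mulr_suml => /eqP; rewrite -subr_eq0 -sumrN => /eqP.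
    move=> h; rewrite -[RHS]h; congr (_ + _); apply: eq_bigr => k _.
      by rewrite !mulrA.
    by rewrite !mulNr !mulrA.
  exact: lspan0.
have := finite_rank_functional
  (p := fun k => if (k < n)%N then e * p k else - p (k - n)%N)
  (q := fun k => if (k < n)%N then q k else q (k - n)%N * e) h0 l.
rewrite big_split_ord/=.
under eq_bigr => k _ do rewrite ltn_ord lE//.
under [X in _ + X]eq_bigr => k _ do rewrite ltnNge leq_addr/= addKn.
rewrite (bigD1 (Ordinal k0n))//= eqxx scale1r big1 => [|k]; last first.
  by rewrite -val_eqE/= => /negbTE->; rewrite scale0r.
rewrite addr0 => /eqP; rewrite addr_eq0 => /eqP eE.
rewrite -[e](mulrK (hD pk0)) eE mulNr mulr_suml -sumrN.
apply: lspan_sum => k _; rewrite -scalerAl mulNr scalerN opprK.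
by apply/lspanZ/lspan_mem/mapP; exists (val k) => //; rewrite mem_iota/= add0n.
Qed.

End MultiplicationOperators.

(** * Power identities over an infinite field *)

Lemma infinite_image (T U : Type) (A : set T) (f : T -> U) :
  injective f -> infinite_set A -> infinite_set (f @` A).
Proof.
move=> fi; apply: contra_not => /(finite_preimage (f := f)) h.
by apply: sub_finite_set (h _) => [x Ax|x y _ _ /fi//]; exists x.
Qed.

Lemma infinite_fiber (T U : Type) (A : set T) (f : T -> U) (B : set U) :
  infinite_set A -> finite_set B -> (forall x, A x -> B (f x)) ->
  exists u, infinite_set [set x | A x /\ f x = u].
Proof.
move=> Ai Bf fB; apply: contrapT => nu; apply: Ai.
apply: (@sub_finite_set _ _ (\bigcup_(u in B) [set x | A x /\ f x = u])).
  by move=> x Ax; exists (f x) => //; exact: fB.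
apply: bigcup_finite => // u _; apply: contrapT => h; apply: nu; exists u; exact: h.
Qed.

Section CentralEvaluation.
Variables (R : unitRingType) (hR : division_ring R).
Implicit Types (P Q : {poly R}) (t : R).

Definition central : set R := [set t | forall x, x * t = t * x].

Lemma central_comm_poly P t : central t -> comm_poly P t.
Proof. by move=> ct; rewrite /comm_poly ct. Qed.

Lemma horner_centralM P Q t : central t -> (P * Q).[t] = P.[t] * Q.[t].
Proof. by move=> ct; apply/hornerM_comm/central_comm_poly. Qed.

Lemma horner_centralX P t n : central t -> (P ^+ n).[t] = P.[t] ^+ n.
Proof.
move=> ct; elim: n => [|n IH]; first by rewrite !expr0 hornerC.
by rewrite !exprS horner_centralM// IH.
Qed.

(** Distinct central roots commute and differ by a unit, which the root bound asks for over a
    noncommutative ring. *)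
Lemma finite_central_roots P : P != 0 -> finite_set [set t | central t /\ P.[t] = 0].
Proof.
move=> P0; apply: contrapT => /(infinite_set_fset (size P))[B Bs].
pose S : seq R := finmap.enum_fset B; have SB t : t \in S -> central t /\ P.[t] = 0 by move=> /Bs.
have uS : uniq S := finmap.fset_uniq B.
rewrite leqNgt => /negP; apply; apply: (@max_ring_poly_roots R P S P0).
  by apply/allP => t /SB[_ Pt]; rewrite /root Pt.
elim: S uS SB => [//|t s IH] /= /andP[ts us] ct.
rewrite IH ?andbT//; last by move=> u us'; apply: ct; rewrite inE us' orbT.
apply/allP => u us'; rewrite /diff_roots (ct u _).1 ?inE ?us' ?orbT// eqxx/=.
by apply: hR; rewrite subr_eq0; apply: contraNneq ts => <-.
Qed.

Lemma infinite_central_roots P (T : set R) : infinite_set T ->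
  (forall t, T t -> central t /\ P.[t] = 0) -> P = 0.
Proof.
move=> Ti TP; apply: contrapT => /eqP/finite_central_roots; apply: contra_not Ti.
by apply: sub_finite_set => t /TP.
Qed.

End CentralEvaluation.

Arguments central {R}.

Section PowerIdentities.
Variables (F : fieldType) (D : unitAlgType F).
Hypotheses (hD : division_ring D) (hF : has_center D).
Hypothesis infD : ~ finite_rank [set: D].
Hypothesis infF : infinite_set [set: F].
Implicit Types (x y z : D) (s : F) (l : {scalar D}) (G : {poly D}).

Lemma central_scalar s : central (s%:A : D).
Proof. by move=> x; rewrite mulr_algr mulr_algl. Qed.

Lemma poly_scalar_roots G : (forall s, G.[s%:A] = 0) -> G = 0.
Proof.
move=> G0; apply: (infinite_central_roots hD (T := range (fun s : F => s%:A))).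
  have inj : injective (fun s : F => s%:A : D).
    exact: (fmorph_inj (in_alg D)).
  exact: infinite_image.
by move=> _ [s _ <-]; split; [exact: central_scalar | exact: G0].
Qed.

(** Polynomial dependence is asked along affine lines: this suffices to differentiate in a direction
    and avoids coordinates on [D]. *)
Definition poly_on_lines (mu : D -> F) :=
  forall y z, exists P : {poly F}, forall s, mu (y + s *: z) = P.[s].

Lemma poly_on_linesM mu nu : poly_on_lines mu -> poly_on_lines nu ->
  poly_on_lines (fun y => mu y * nu y).
Proof.
move=> hm hn y z; have [[P PE] [Q QE]] := (hm y z, hn y z).
by exists (P * Q) => s; rewrite hornerM PE QE.
Qed.

Lemma poly_on_lines_cst (c : F) : poly_on_lines (fun=> c).
Proof. by move=> y z; exists c%:P => s; rewrite hornerC. Qed.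

Lemma poly_on_lines_det n (A : D -> 'M[F]_n) :
  (forall i j, poly_on_lines (fun y => A y i j)) -> poly_on_lines (fun y => \det (A y)).
Proof.
move=> hA y z.
have /choice[P PE] : forall i : 'I_n, exists P : 'I_n -> {poly F},
    forall j s, A (y + s *: z) i j = (P j).[s].
  by move=> i; have [Q QE] := choice (fun j => hA i j y z); exists Q.
exists (\det (\matrix_(i, j) P i j)) => s.
rewrite -horner_evalE -det_map_mx; congr (\det _); apply/matrixP => i j.
by rewrite !mxE PE.
Qed.

Lemma horner_functional l G s : l G.[s%:A] = (map_poly l G).[s].
Proof.
rewrite horner_poly horner_coef linear_sum; apply: eq_bigr => i _.
by rewrite exprZn expr1n mulr_algr linearZ mulrC.
Qed.

Variables (f : D -> D) (N : nat) (p q : nat -> D) (k0 : nat).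
Hypothesis fE : forall y, f y = \sum_(k < N) p k * y * q k.

Lemma f_line y z s : f (y + s *: z) = f y + s *: f z.
Proof.
rewrite !fE scaler_sumr -big_split/=; apply: eq_bigr => k _.
by rewrite mulrDr mulrDl -scalerAr -scalerAl.
Qed.

Definition fline y z : {poly D} := (f y)%:P + (f z)%:P * 'X.

Lemma horner_fline y z s n : (fline y z ^+ n).[s%:A] = f (y + s *: z) ^+ n.
Proof.
rewrite horner_centralX; last exact: central_scalar.
by rewrite f_line /fline hornerD hornerMX !hornerC mulr_algr.
Qed.

Lemma coef0_fline y z n : (fline y z ^+ n)`_0 = f y ^+ n.
Proof.
elim: n => [|n IH]; first by rewrite !expr0 coef1.
by rewrite !exprS coefM big_ord1 IH /fline coefD coefC coefMX/= addr0.
Qed.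

(** Noncommutative product rule: the varied factor [f z] can stand at any of the [n] places. *)
Lemma coef1_fline y z n :
  (fline y z ^+ n)`_1 = \sum_(a < n) f y ^+ a * f z * f y ^+ (n - a.+1).
Proof.
elim: n => [|n IH]; first by rewrite expr0 coef1 big_ord0.
rewrite exprS coefM !big_ord_recl big_ord0/= addr0 coef0_fline IH.
rewrite /fline !coefD !coefC !coefMX/= !coefC/= addr0 add0r mulr_sumr addrC.
rewrite expr0 mul1r subn1/=; congr (_ + _); apply: eq_bigr => a _.
by rewrite /bump/= add1n !mulrA -exprS subSS.
Qed.

Lemma poly_on_lines_power l c e n : poly_on_lines (fun y => l (c * f y ^+ n * e)).
Proof.
move=> y z; exists (map_poly l (c%:P * fline y z ^+ n * e%:P)) => s.
rewrite -horner_functional !horner_centralM; try exact: central_scalar.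
by rewrite !hornerC horner_fline.
Qed.

(** Constants stand on the right only. This shape survives differentiation followed by [l] on the
    second tensor factor, since everything to the right of the varied factor becomes a scalar. *)
Inductive lower m : (D -> D) -> Prop :=
| lower0 : lower m (fun=> 0)
| lower_cons mu i e g : poly_on_lines mu -> (i < m)%N -> lower m g ->
    lower m (fun y => mu y *: (f y ^+ i * e) + g y).

Lemma lowerD m g h : lower m g -> lower m h -> lower m (fun y => g y + h y).
Proof.
move=> + hh; elim=> [|mu i e k hmu im _ IH].
  by rewrite (_ : (fun y => _) = h)//; apply/funext => y; rewrite add0r.
rewrite (_ : (fun y => _) = fun y => mu y *: (f y ^+ i * e) + (k y + h y)).
  exact: lower_cons.
by apply/funext => y; rewrite addrA.
Qed.

Lemma lower_sum m n (g : nat -> D -> D) : (forall i, (i < n)%N -> lower m (g i)) ->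
  lower m (fun y => \sum_(i < n) g i y).
Proof.
elim: n => [|n IH] h.
  rewrite (_ : (fun y => _) = fun=> 0); first exact: lower0.
  by apply/funext => y; rewrite big_ord0.
rewrite (_ : (fun y => _) = fun y => \sum_(i < n) g i y + g n y).
  by apply/lowerD/h => //; apply: IH => i iln; apply/h/ltnW.
by apply/funext => y; rewrite big_ord_recr.
Qed.

Lemma lower_term m mu i e : poly_on_lines mu -> (i < m)%N ->
  lower m (fun y => mu y *: (f y ^+ i * e)).
Proof.
move=> hmu im; rewrite (_ : (fun y => _) = fun y => mu y *: (f y ^+ i * e) + 0).
  exact/lower_cons/lower0.
by apply/funext => y; rewrite addr0.
Qed.

(* [X] is the operator of a tensor on which [id (x) l] takes the value [h]. *)
Definition tensor l (X : D -> D) h := exists n (p' q' : nat -> D),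
  (forall z, X z = \sum_(k < n) p' k * z * q' k) /\ \sum_(k < n) l (q' k) *: p' k = h.

Lemma tensor0 l : tensor l (fun=> 0) 0.
Proof. by exists 0%N, (fun=> 0), (fun=> 0); split=> [z|]; rewrite big_ord0. Qed.

Lemma tensor1 l a b : tensor l (fun z => a * z * b) (l b *: a).
Proof. by exists 1%N, (fun=> a), (fun=> b); split=> [z|]; rewrite big_ord1. Qed.

Lemma tensorD l X1 X2 h1 h2 : tensor l X1 h1 -> tensor l X2 h2 ->
  tensor l (fun z => X1 z + X2 z) (h1 + h2).
Proof.
move=> [n1 [p1 [q1 [X1E h1E]]]] [n2 [p2 [q2 [X2E h2E]]]].
exists (n1 + n2)%N, (fun k => if (k < n1)%N then p1 k else p2 (k - n1)%N),
  (fun k => if (k < n1)%N then q1 k else q2 (k - n1)%N); split=> [z|].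
  rewrite X1E X2E big_split_ord/=; congr (_ + _); apply: eq_bigr => k _.
    by rewrite ltn_ord.
  by rewrite ltnNge leq_addr/= addKn.
rewrite -h1E -h2E big_split_ord/=; congr (_ + _); apply: eq_bigr => k _.
  by rewrite ltn_ord.
by rewrite ltnNge leq_addr/= addKn.
Qed.

Lemma tensor_sum l n (X : nat -> D -> D) (h : nat -> D) :
  (forall i, tensor l (X i) (h i)) ->
  tensor l (fun z => \sum_(i < n) X i z) (\sum_(i < n) h i).
Proof.
move=> hX; elim: n => [|n IH].
  rewrite big_ord0 (_ : (fun z => _) = fun=> 0); first exact: tensor0.
  by apply/funext => z; rewrite big_ord0.
rewrite big_ord_recr (_ : (fun z => _) = fun z => \sum_(i < n) X i z + X n z).
  exact: tensorD.
by apply/funext => z; rewrite big_ord_recr.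
Qed.

(* Up to an operator of finite rank, the derivative of [g] at [y] is the
   operator of a tensor on which [id (x) l] takes the value [h]. *)
Definition derives l (g : D -> D) y h := exists (X : D -> D) (r : seq D),
  tensor l X h /\ forall z, exists G : {poly D},
    (forall s : F, g (y + s *: z) = G.[s%:A]) /\ lspan r (G`_1 - X z).

Lemma derivesD l g1 g2 y h1 h2 : derives l g1 y h1 -> derives l g2 y h2 ->
  derives l (fun y => g1 y + g2 y) y (h1 + h2).
Proof.
move=> [X1 [s1 [hX1 G1]]] [X2 [s2 [hX2 G2]]].
exists (fun z => X1 z + X2 z), (s1 ++ s2); split; first exact: tensorD.
move=> z; have [[P1 [P1E sp1]] [P2 [P2E sp2]]] := (G1 z, G2 z).
exists (P1 + P2); split=> [s|]; first by rewrite hornerD P1E P2E.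
rewrite coefD opprD addrACA; apply: lspanD.
  by apply: lspan_sub sp1 => v; rewrite mem_cat => ->.
by apply: lspan_sub sp2 => v; rewrite mem_cat => ->; rewrite orbT.
Qed.

Lemma derives0 l y : derives l (fun=> 0) y 0.
Proof.
exists (fun=> 0), [::]; split; first exact: tensor0.
by move=> z; exists 0; split=> [s|]; rewrite ?horner0// coef0 subr0; exact: lspan0.
Qed.

(** Varying [mu] gives multiples of the fixed vector [f y ^+ i * e], which are dropped as an
    operator of finite rank. Varying the factor in place [a] leaves [f y ^+ a * p k] on the left,
    and [l] turns the part on the right into a scalar. *)
Lemma derives_term l mu i e y : poly_on_lines mu ->
  derives l (fun y => mu y *: (f y ^+ i * e)) y
    (\sum_(a < i) \sum_(k < N)
       (mu y * l (q k * f y ^+ (i - a.+1) * e)) *: (f y ^+ a * p k)).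
Proof.
move=> hmu.
exists (fun z => \sum_(a < i) \sum_(k < N)
  mu y *: (f y ^+ a * p k) * z * (q k * f y ^+ (i - a.+1) * e)).
exists [:: f y ^+ i * e]; split.
  apply: (@tensor_sum l _ (fun a z => \sum_(k < N) mu y *: (f y ^+ a * p k) * z
    * (q k * f y ^+ (i - a.+1) * e)) (fun a => \sum_(k < N)
       (mu y * l (q k * f y ^+ (i - a.+1) * e)) *: (f y ^+ a * p k))) => a.
  apply: (@tensor_sum l _ (fun k z => mu y *: (f y ^+ a * p k) * z
    * (q k * f y ^+ (i - a.+1) * e)) (fun k =>
       (mu y * l (q k * f y ^+ (i - a.+1) * e)) *: (f y ^+ a * p k))) => k.
  by rewrite mulrC -scalerA; exact: tensor1.
move=> z; have [P PE] := hmu y z.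
exists (map_poly (in_alg D) P * fline y z ^+ i * e%:P); split=> [s|].
  rewrite !horner_centralM; try exact: central_scalar.
  by rewrite hornerC horner_fline horner_map/= -PE mulr_algl -scalerAl.
rewrite coefMC coefM !big_ord_recl big_ord0/= addr0 coef0_fline coef1_fline.
rewrite !coef_map/= !mulr_algl.
have -> : P`_0 = mu y by rewrite -horner_coef0 -PE scale0r addr0.
have -> : \sum_(a < i) \sum_(k < N)
    mu y *: (f y ^+ a * p k) * z * (q k * f y ^+ (i - a.+1) * e) =
  mu y *: (\sum_(a < i) f y ^+ a * f z * f y ^+ (i - a.+1)) * e.
  rewrite scaler_sumr mulr_suml; apply: eq_bigr => a _.
  rewrite [f z]fE mulr_sumr !mulr_suml scaler_sumr mulr_suml; apply: eq_bigr => k _.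
  by rewrite -!scalerAl !mulrA.
rewrite mulrDl addrAC subrr add0r -scalerAl.
by apply/lspanZ/lspan_mem; rewrite inE.
Qed.

(** Outside the scalars only the [a < i] factors to the left of the varied one remain, so the degree
    in [f y] drops. *)
Lemma derives_lower l m g : lower m.+1 g ->
  exists h, lower m h /\ forall y, derives l g y (h y).
Proof.
elim=> [|mu i e g' hmu im _ [h [hl hd]]].
  by exists (fun=> 0); split=> [|y]; [exact: lower0 | exact: derives0].
exists (fun y => \sum_(a < i) \sum_(k < N)
       (mu y * l (q k * f y ^+ (i - a.+1) * e)) *: (f y ^+ a * p k) + h y).
split=> [|y]; last by apply/derivesD/hd/derives_term.
apply: lowerD => //; apply: (lower_sum (g := fun a y => \sum_(k < N)
       (mu y * l (q k * f y ^+ (i - a.+1) * e)) *: (f y ^+ a * p k))) => a ai.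
apply: (lower_sum (g := fun k y =>
       (mu y * l (q k * f y ^+ (i - a.+1) * e)) *: (f y ^+ a * p k))) => k _.
apply: lower_term; last exact: leq_trans ai _.
exact/poly_on_linesM/poly_on_lines_power.
Qed.

(** The polynomial of a zero function on a line has all scalars as roots and is zero, as [F] is
    infinite. So the tensor defines an operator of finite rank, and [finite_rank_functional]
    applies. *)
Lemma derives_eq0 l g y h : (forall y, g y = 0) -> derives l g y h -> h = 0.
Proof.
move=> g0 [X [r [[n [p' [q' [XE <-]]]] hG]]].
apply: (finite_rank_functional hD hF infD (s := r)) => z; rewrite -XE.
have [G [GE]] := hG z; rewrite (poly_scalar_roots (G := G)); last by move=> s; rewrite -GE.
by rewrite coef0 sub0r => /(lspanZ (-1)); rewrite scaleN1r opprK.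
Qed.

Hypotheses (fr : free_family N q) (k0N : (k0 < N)%N) (pk0 : p k0 != 0).

(* Differentiate at [y] and keep the terms in which the varied factor comes
   last: this lowers [m] by one. *)
Lemma power_leading_coef m c eta g : c != 0 -> poly_on_lines eta -> lower m g ->
  (forall y, eta y *: (f y ^+ m * c) + g y = 0) -> forall y, eta y = 0.
Proof.
elim: m c g => [|m IH] c g c0 heta hg gE y.
  have g0 : g y = 0 by case: hg => // mu i e g' _; rewrite ltn0.
  have /eqP := gE y; rewrite g0 expr0 mul1r addr0 scaler_eq0 (negbTE c0) orbF.
  by move=> /eqP.
(* Right multiplication by [c] keeps the right factors free, so [l] can be chosen dual to
   [q k0 * c]. *)
have frc : free_family N (fun k => q k * c).
  move=> d h; apply: fr; rewrite -[LHS](mulrK (hD c0)) mulr_suml.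
  by under eq_bigr => k _ do rewrite -scalerAl; rewrite h mul0r.
have [l lE] := free_family_dual frc k0N.
have [h [hl hd]] := derives_lower l hg.
apply: (IH (p k0) (fun y => \sum_(a < m) \sum_(k < N)
  (eta y * l (q k * f y ^+ (m.+1 - a.+1) * c)) *: (f y ^+ a * p k) + h y)) => //.
  apply: lowerD => //; apply: (lower_sum (g := fun a y => \sum_(k < N)
       (eta y * l (q k * f y ^+ (m.+1 - a.+1) * c)) *: (f y ^+ a * p k))) => a ai.
  apply: (lower_sum (g := fun k y =>
       (eta y * l (q k * f y ^+ (m.+1 - a.+1) * c)) *: (f y ^+ a * p k))) => k _.
  by apply: lower_term => //; exact/poly_on_linesM/poly_on_lines_power.
move=> z; have := derives_eq0 gE (derivesD (derives_term l m.+1 c z heta) (hd z)).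
rewrite big_ord_recr/=.
(* For [a = m] only [q k * c] stands to the right, and [l] selects [k = k0]: this is the new leading
   term, with [p k0] in place of [c]. *)
have -> : \sum_(k < N) (eta z * l (q k * f z ^+ (m.+1 - m.+1) * c)) *: (f z ^+ m * p k) =
    eta z *: (f z ^+ m * p k0).
  rewrite subnn expr0 (bigD1 (Ordinal k0N))//= mulr1 lE// eqxx mulr1.
  rewrite big1 ?addr0// => k; rewrite -val_eqE/= mulr1 lE// => /negbTE->.
  by rewrite mulr0 scale0r.
by move=> h0; apply: etrans h0; rewrite addrCA addrA.
Qed.

End PowerIdentities.

(** * Unbounded degree of the values of a nonzero operator *)

Section BoundedDegree.
Variables (F : fieldType) (D : unitAlgType F).
Hypotheses (hD : division_ring D) (hF : has_center D).
Hypothesis infD : ~ finite_rank [set: D].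
Hypothesis infF : infinite_set [set: F].
Implicit Types (l : {scalar D}).

Lemma not_free_family_ord (V : lmodType F) n (v : nat -> V) : ~ free_family n v ->
  exists2 c : 'rV[F]_n, c != 0 & \sum_(i < n) c 0 i *: v i = 0.
Proof.
move=> nf; apply: contrapT => nc; apply: nf => c cE i iln.
apply/eqP/negPn/negP => ci; apply: nc; exists (\row_j c j).
  by apply/eqP => /rowP/(_ (Ordinal iln)); rewrite !mxE; apply/eqP.
by rewrite -[RHS]cE; apply: eq_bigr => j _; rewrite mxE.
Qed.

(* Cramer's rule: the cofactors of the first row of the matrix with further
   rows [l_i w^k] are the coefficients of a dependency between the powers. *)
Lemma cofactor_dependency m (l : 'I_m.+1 -> {scalar D}) (w : D) :
  ~ free_family m.+2 (fun i => w ^+ i : D) ->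
  let A := \matrix_(i < m.+2, k < m.+2) oapp (fun j => l j (w ^+ k)) 0 (unlift ord0 i) in
  \sum_(k < m.+2) cofactor A ord0 k *: w ^+ k = 0.
Proof.
move=> /not_free_family_ord[c c0 cE] A; apply: functional0 => g.
(* Filling the zero first row of [A] with the [g (w ^+ k)] does not change the cofactors of that
   row, and the dependency [c] makes the determinant vanish. *)
pose B := \matrix_(i < m.+2, k < m.+2)
  oapp (fun j => l j (w ^+ k)) (g (w ^+ k)) (unlift ord0 i).
have detB : \det B = 0.
  apply/eqP; rewrite -det_tr; apply/det0P; exists c => //.
  apply/rowP => i; rewrite !mxE.
  under eq_bigr => k _ do rewrite !mxE.
  case: unliftP => [j _|_] /=.
    under eq_bigr => k _ do rewrite -linearZ.
    by rewrite -linear_sum cE linear0.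
  under eq_bigr => k _ do rewrite -linearZ.
  by rewrite -linear_sum cE linear0.
rewrite -[RHS]detB (expand_det_row B ord0) linear_sum; apply: eq_bigr => k _.
rewrite linearZ/= mulrC !mxE unlift_none/=; congr (_ * (_ * \det _)).
by apply/matrixP => i j; rewrite !mxE !liftK.
Qed.

(** Induction on [m], by contradiction. Suppose the powers up to [m] are free at [y], with dual
    functionals [l], while those up to [m + 1] are dependent everywhere. The cofactors are
    polynomial coefficients of a relation of degree [m + 1], and the leading one vanishes
    identically by [power_leading_coef]; but at [y] it is a sign times the determinant of the
    identity. *)
Lemma mulop_unbounded_degree (f : D -> D) m : mulop f -> (exists y, f y <> 0) ->
  exists y, free_family m.+1 (fun i => f y ^+ i : D).
Proof.
move=> fM f0; have [N [p [q [k0 [fE fr k0N pk0]]]]] := mulop_free fM f0.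
apply: contrapT => /forallNP nfree.
elim: m nfree => [|m IH] nfree.
  apply: (nfree 0) => c; rewrite big_ord1 expr0 => /eqP.
  by rewrite scaler_eq0 oner_eq0 orbF => /eqP c0 [].
apply: IH => y fry.
have /choice[l lE] : forall k : 'I_m.+1, exists l : {scalar D},
    forall i, (i < m.+1)%N -> l (f y ^+ i) = (i == k)%:R.
  by move=> k; apply: free_family_dual fry (ltn_ord k).
pose A z := \matrix_(i < m.+2, k < m.+2)
  oapp (fun j => l j (f z ^+ k)) 0 (unlift ord0 i).
have hA k : poly_on_lines (fun z => cofactor (A z) ord0 k).
  apply: poly_on_linesM; first exact: poly_on_lines_cst.
  apply: poly_on_lines_det => i j y' z.
  have [P PE] := poly_on_lines_power fE (l i) 1 1 (lift k j) y' z.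
  by exists P => s; rewrite -PE !mxE liftK/= mul1r mulr1.
have low : lower f m.+1 (fun z => \sum_(k < m.+1) cofactor (A z) ord0 (inord k) *: (f z ^+ k * 1)).
  apply: (@lower_sum _ _ f m.+1 m.+1
    (fun k z => cofactor (A z) ord0 (inord k) *: (f z ^+ k * 1))) => k km.
  exact: lower_term.
have := power_leading_coef hD hF infD infF fE fr k0N pk0 (oner_neq0 D) (hA ord_max) low.
have E z : cofactor (A z) ord0 ord_max *: (f z ^+ m.+1 * 1) +
     \sum_(k < m.+1) cofactor (A z) ord0 (inord k) *: (f z ^+ k * 1) = 0.
  have /= h := cofactor_dependency l (nfree z); rewrite big_ord_recr/= in h.
  apply: etrans h; rewrite addrC mulr1; congr (_ + _).
  apply: eq_bigr => k _; rewrite mulr1; congr (cofactor _ _ _ *: _).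
  by apply/val_inj; rewrite /= inordK// leqW// ltn_ord. 
move=> /(_ E y) /eqP; apply/negP; rewrite /cofactor mulf_neq0 ?signr_eq0//.
rewrite (_ : row' _ _ = 1%:M) ?det1 ?oner_neq0//; apply/matrixP => i j.
rewrite !mxE liftK lift_max; change (l i (f y ^+ j) = (i == j)%:R).
by rewrite lE ?ltn_ord// eq_sym.
Qed.

End BoundedDegree.

(** * Rational curves *)

Section Ore.
Variables (R : unitRingType) (hR : division_ring R).
Implicit Types (P Q A B : {poly R}).

(** Gaussian elimination with coefficients on the left: either the last equation is void, or it is
    solved for the unknown [j0]. *)
Lemma underdetermined_system n (M : 'I_n -> 'I_n.+1 -> R) :
  exists2 x : 'I_n.+1 -> R, (exists j, x j != 0) & forall i, \sum_j M i j * x j = 0.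
Proof.
elim: n M => [|n IH] M; first by exists (fun=> 1) => [|[]//]; exists ord0; exact: oner_neq0.
have [[j0 Mj0]|M0] := pselect (exists j0, M ord_max j0 != 0); last first.
  have [x [j xj] xM] := IH (fun i k => M (lift ord_max i) (lift ord_max k)).
  exists (fun j => oapp x 0 (unlift ord_max j)).
    by exists (lift ord_max j); rewrite liftK.
  move=> i; case: (unliftP ord_max i) => [i' ->|->]; last first.
    rewrite big1// => k _; have [->|Mk] := eqVneq (M ord_max k) 0; first by rewrite mul0r.
    by case: M0; exists k.
  rewrite (bigD1_ord ord_max)//= unlift_none/= mulr0 add0r -[RHS](xM i').
  by apply: eq_bigr => k _; rewrite liftK.
have [x [j xj] xM] := IH (fun i k => M (lift ord_max i) (lift j0 k)
  - M (lift ord_max i) j0 * (M ord_max j0)^-1 * M ord_max (lift j0 k)).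
pose y := - (M ord_max j0)^-1 * \sum_k M ord_max (lift j0 k) * x k.
exists (fun j => oapp x y (unlift j0 j)).
  by exists (lift j0 j); rewrite liftK.
move=> i; rewrite (bigD1_ord j0)//= unlift_none/=.
under eq_bigr => k _ do rewrite liftK/=.
case: (unliftP ord_max i) => [i' ->|->]; last first.
  by rewrite /y mulNr mulrN mulVKr ?addNr//; exact: hR.
rewrite -[RHS](xM i'); under [RHS]eq_bigr => k _ do rewrite mulrBl -[X in _ - X]mulrA.
by rewrite sumrB -mulr_sumr addrC /y mulNr mulrN mulrA.
Qed.

(** Constant coefficient 1 makes [Q] invertible as a power series. *)
Lemma mul_coef0_eq1 Q A : Q`_0 = 1 -> Q * A = 0 -> A = 0.
Proof.
move=> Q0 QA; apply/polyP => i; rewrite coef0.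
elim/ltn_ind: i => i IH; have := congr1 (fun P => P`_i) QA.
rewrite coefM coef0 big_ord_recl/= subn0 Q0 mul1r big1 ?addr0// => j _.
by rewrite IH ?mulr0// /bump/= add1n ltn_subrL/= (leq_ltn_trans _ (ltn_ord j)).
Qed.

Lemma polyX_factor A : A`_0 = 0 -> A = (\poly_(i < (size A).-1) A`_i.+1) * 'X.
Proof.
move=> A0; apply/polyP => -[|i]; rewrite coefMX//= coef_poly.
by case: ltnP => // h; rewrite nth_default//; case: (size A) h.
Qed.

Lemma polyX_cancel A B : A * 'X = B * 'X -> A = B.
Proof.
by move=> AB; apply/polyP => i; have := congr1 (fun P => P`_i.+1) AB; rewrite !coefMX.
Qed.

(** Compare coefficients in [P * B = Q * A] with [A] and [B] of size at most [n + 1]: there are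
    [2 n + 2] unknowns and [2 n + 1] equations. If [B] were 0 then [A] would be 0 too, against the
    nontrivial solution. *)
Lemma ore_nonzero P Q : Q`_0 = 1 -> exists A B, B != 0 /\ P * B = Q * A.
Proof.
move=> Q0; pose n := maxn (size P) (size Q).
pose M (i : 'I_(n + n.+1)) (j : 'I_(n.+1 + n.+1)) :=
  if (j <= n)%N then (P * 'X^j)`_i else - (Q * 'X^(j - n.+1))`_i.
have [x [j xj] xM] := underdetermined_system M.
pose y (j : nat) := oapp x 0 (insub j).
pose B := \sum_(j < n.+1) 'X^j * (y j)%:P.
pose A := \sum_(j < n.+1) 'X^j * (y (n.+1 + j)%N)%:P.
have yE (i : 'I_(n.+1 + n.+1)) : y i = x i by rewrite /y valK.
have coefS (z : nat -> R) i :
    (\sum_(j < n.+1) 'X^j * (z j)%:P)`_i = if (i <= n)%N then z i else 0.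
  rewrite coef_sum; under eq_bigr => k _ do rewrite coefMC coefXn.
  case: leqP => h.
    rewrite (bigD1 (Ordinal (h : (i < n.+1)%N)))//= eqxx mul1r big1 ?addr0// => k.
    by rewrite -val_eqE/= eq_sym => /negbTE->; rewrite mul0r.
  by rewrite big1// => k _; rewrite gtn_eqF ?mul0r// (leq_trans (ltn_ord k)).
have szS (z : nat -> R) : (size (\sum_(j < n.+1) 'X^j * (z j)%:P)%R <= n.+1)%N.
  by apply/leq_sizeP => i h; rewrite coefS leqNgt h.
have PBQA : P * B = Q * A.
  apply/eqP; rewrite -subr_eq0; apply/eqP/polyP => i; rewrite coef0.
  have [h|h] := ltnP i (n + n.+1); last first.
    have sz (S T : {poly R}) : (size S <= n)%N -> (size T <= n.+1)%N -> (S * T)`_i = 0.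
      move=> hS hT; apply: nth_default; apply: leq_trans (size_polyMleq _ _) _.
      exact: leq_trans (leq_pred _) (leq_trans (leq_add hS hT) h).
    have sB : (size B <= n.+1)%N := szS y.
    have sA : (size A <= n.+1)%N := szS (fun j => y (n.+1 + j)%N).
    by rewrite coefB !sz ?subr0 ?leq_maxl ?leq_maxr.
  have := xM (Ordinal h); rewrite (@big_split_ord _ _ _ n.+1 n.+1)/= => h0.
  apply: etrans h0; rewrite coefB !mulr_sumr !coef_sum -sumrN; congr (_ + _); apply: eq_bigr => k _.
    by rewrite /M/= -ltnS ltn_ord mulrA coefMC -(yE (lshift _ k)).
  by rewrite /M/= leqNgt ltnS leq_addr/= addKn mulrA coefMC -(yE (rshift _ k)) mulNr.
exists A, B; split=> //; apply/eqP => B0; move/eqP: xj; apply.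
have A0 : A = 0 by apply: (mul_coef0_eq1 Q0); rewrite -PBQA B0 mulr0.
rewrite -(yE j); case: (leqP j n) => h.
  by have := congr1 (fun P => P`_j) B0; rewrite /B coefS h coef0.
have jn : (j - n.+1 <= n)%N.
  by move: (nat_of_ord j) (ltn_ord j) => k; rewrite ltnS leq_subLR addSnnS.
have := congr1 (fun P => P`_(j - n.+1)) A0.
by rewrite /A (coefS (fun j => y (n.+1 + j)%N)) jn coef0 subnKC.
Qed.

(** If [B] vanishes at 0 then so does [A], because [Q] has constant coefficient 1, and a factor ['X]
    cancels; otherwise normalise by the constant coefficient of [B]. *)
Lemma ore P Q : Q`_0 = 1 -> exists A B, B`_0 = 1 /\ P * B = Q * A.
Proof.
move=> Q0; have [A [B [B0 PB]]] := ore_nonzero P Q0.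
elim: {B}(size B).+1 {-2}B A (ltnSn (size B)) B0 PB => // m IH B A sB B0 PB.
have [b0|b0] := eqVneq (B`_0) 0; last first.
  exists (A * (B`_0)^-1%:P), (B * (B`_0)^-1%:P); rewrite coefMC divrr//; last exact: hR.
  by rewrite !mulrA PB.
have a0 : A`_0 = 0.
  have := congr1 (fun P => P`_0) PB.
  by rewrite !coefM !big_ord1 b0 Q0 mulr0 mul1r.
have [BE AE] := (polyX_factor b0, polyX_factor a0).
apply: IH (_ : _ * (\poly_(i < (size B).-1) B`_i.+1) = _ * (\poly_(i < (size A).-1) A`_i.+1)).
- rewrite -ltnS (leq_trans _ sB)// ltnS; apply: leq_ltn_trans (size_poly _ _) _.
  by rewrite ltn_predL size_poly_gt0.
- by apply: contraNneq B0 => h; rewrite BE h mul0r.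
- by apply: polyX_cancel; rewrite -!mulrA -BE -AE.
Qed.

End Ore.

(** * Germs of rational curves through 1 *)

Section Germs.
Variables (R : unitRingType) (hR : division_ring R).
Implicit Types (P Q A B : {poly R}) (x y : R -> R) (a w t : R) (T : set R).

Definition central_ae (H : set R) := finite_set [set t | central t /\ ~ H t].

Lemma central_aeI H K : central_ae H -> central_ae K ->
  central_ae [set t | H t /\ K t].
Proof.
move=> hH hK; apply: (@sub_finite_set _ _
    ([set t | central t /\ ~ H t] `|` [set t | central t /\ ~ K t])).
  by move=> t [ct /not_andP[h|h]]; [left | right].
by rewrite finite_setU.
Qed.

Lemma sub_central_ae H K : (forall t, central t -> H t -> K t) ->
  central_ae H -> central_ae K.
Proof.
move=> HK; apply: sub_finite_set => t [ct nK]; split=> // Ht.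
exact/nK/HK.
Qed.

Lemma central_ae_root_neq0 P : P`_0 = 1 -> central_ae [set t | P.[t] != 0].
Proof.
move=> P0; apply: (@sub_finite_set _ _ [set t | central t /\ P.[t] = 0]).
  by move=> t [ct /negP/negPn/eqP].
apply: finite_central_roots => //; apply/eqP => PE.
by move/eqP: P0; rewrite PE coef0 eq_sym oner_eq0.
Qed.

Lemma infinite_central_ae T H : infinite_set T -> T `<=` central -> central_ae H ->
  infinite_set [set t | T t /\ H t].
Proof.
move=> Ti Tc hH; apply: sub_infinite_set (infinite_setD Ti hH) => t [Tt nt].
split=> //; apply: contrapT => nH; apply: nt; split=> //; exact: Tc.
Qed.

(* [x] is, off a finite set of central elements [t], a rational expression
   [P t / Q t] with Taylor expansion [1 + t * w + ...] at [0]. *)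
Definition germ x w := exists P Q, [/\ P`_0 = 1, Q`_0 = 1, w = P`_1 - Q`_1 &
  central_ae [set t | [/\ P.[t] != 0, Q.[t] != 0 & x t = P.[t] / Q.[t]]]].

Lemma germ_line w : germ (fun t => 1 + w * t) w.
Proof.
exists (1 + w%:P * 'X), 1; split.
- by rewrite coefD coef1 coefMX addr0.
- by rewrite coef1.
- by rewrite coefD !coef1 coefMX coefC add0r subr0.
- apply: (sub_central_ae (H := [set t | (1 + w%:P * 'X).[t] != 0])).
    move=> t ct h; split=> //; first by rewrite hornerC oner_neq0.
    by rewrite [1.[t]]hornerC divr1 hornerD hornerMX !hornerC.
  by apply: central_ae_root_neq0; rewrite coefD coef1 coefMX addr0.
Qed.

(** With [Q' * B = Q * A] from the Ore condition, [(P / Q) / (P' / Q')] becomes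
    [(P * A) / (P' * B)]. *)
Lemma germ_div x x' w w' : germ x w -> germ x' w' ->
  germ (fun t => x t / x' t) (w - w').
Proof.
move=> [P [Q [P0 Q0 -> xPQ]]] [P' [Q' [P0' Q0' -> xPQ']]].
have [A [B [B0 QB]]] := ore hR Q' Q0.
have A0 : A`_0 = 1.
  have := congr1 (fun P => P`_0) QB.
  by rewrite !coefM !big_ord1 B0 Q0 Q0' !mul1r.
exists (P * A), (P' * B); split.
- by rewrite coefM big_ord1 P0 A0 mulr1.
- by rewrite coefM big_ord1 P0' B0 mulr1.
- have := congr1 (fun P => P`_1) QB.
  rewrite !coefM !big_ord_recl !big_ord0/= !addr0 P0 P0' A0 B0 Q0 Q0' !mul1r !mulr1.
  move=> e; have -> : A`_1 = B`_1 + Q'`_1 - Q`_1 by rewrite e addrK.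
  rewrite opprB opprD !addrA [RHS](AC 6 (1*5*4*3*2*6))/=.
  by rewrite subrr add0r.
apply: sub_central_ae (central_aeI (central_aeI xPQ xPQ') (central_aeI
  (central_ae_root_neq0 A0) (central_ae_root_neq0 B0))) => t ct.
move=> [[[Pt Qt xt] [Pt' Qt' xt']] [At Bt]]; rewrite /= !horner_centralM//.
split; rewrite ?divring_mulf_neq0//.
have QBt : Q'.[t] * B.[t] = Q.[t] * A.[t].
  by rewrite -!horner_centralM// QB.
have uA := hR At; have uB := hR Bt; have uP' := hR Pt'; have uQ' := hR Qt'.
rewrite xt xt' (invrM uP') ?unitrV// invrK (invrM uP' uB).
have -> : Q'.[t] = Q.[t] * A.[t] / B.[t] by rewrite -QBt mulrK.
by rewrite !mulrA divrK// hR.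
Qed.

Lemma germ1 : germ (fun=> 1) 0.
Proof.
exists 1, 1; rewrite coef1 subrr; split=> //.
apply: (@sub_finite_set _ _ set0) (finite_set0 _) => t [ct]; apply.
by split; rewrite !hornerC ?oner_neq0 ?divr1.
Qed.

Lemma germ_conj x w a : a != 0 -> germ x w -> germ (fun t => a * x t * a^-1) (a * w * a^-1).
Proof.
move=> a0 [P [Q [P0 Q0 -> xPQ]]]; have au := hR a0.
exists (a%:P * P * a^-1%:P), (a%:P * Q * a^-1%:P); split.
- by rewrite coefMC coefCM P0 mulr1 divrr.
- by rewrite coefMC coefCM Q0 mulr1 divrr.
- by rewrite !coefMC !coefCM mulrBr mulrBl.
apply: sub_central_ae xPQ => t ct [Pt Qt xt].
rewrite /= !horner_centralM// !hornerC; have uQ := hR Qt.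
split; rewrite ?divring_mulf_neq0 ?invr_neq0//.
have u : a * Q.[t] * a^-1 \is a GRing.unit by rewrite hR// !divring_mulf_neq0// invr_neq0.
by apply: (mulIr u); rewrite xt divrK// !mulrA divrK// divrK.
Qed.

(** The commutator is the quotient of [x] by its conjugate [a * x * a^-1]. *)
Lemma germ_comm x w a : a != 0 -> germ x w ->
  germ (fun t => x t * a * (x t)^-1 * a^-1) (w - a * w * a^-1).
Proof.
move=> a0 xw; have [P [Q [P0 Q0 wE h]]] := germ_div xw (germ_conj a0 xw).
exists P, Q; split=> //; apply: sub_central_ae h => t ct [Pt Qt e]; split=> //.
rewrite -e; have [->|xt0] := eqVneq (x t) 0; first by rewrite !mul0r.
have au := hR a0; have xu := hR xt0.
have u : a * x t * a^-1 \is a GRing.unit by rewrite hR// !divring_mulf_neq0// invr_neq0.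
by apply: (mulIr u); rewrite divrK// !mulrA divrK// divrK// mulrK.
Qed.

Lemma germX x w n : germ x w -> germ (fun t => x t ^+ n) (w *+ n).
Proof.
move=> xw; elim: n => [|n IH]; first exact: germ1.
have := germ_div IH (germ_div germ1 xw); rewrite sub0r opprK mulrSr.
move=> [P [Q [P0 Q0 wE h]]]; exists P, Q; split=> //.
by apply: sub_central_ae h => t ct [Pt Qt e]; split=> //; rewrite -e div1r invrK exprSr.
Qed.

Lemma germ_eq1 x w T : germ x w -> infinite_set T -> T `<=` central ->
  (forall t, T t -> x t = 1) -> w = 0.
Proof.
move=> [P [Q [P0 Q0 -> xPQ]]] Ti Tc x1.
suff -> : P = Q by rewrite subrr.
apply/eqP; rewrite -subr_eq0; apply/eqP.
apply: (infinite_central_roots hR (infinite_central_ae Ti Tc xPQ)).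
move=> t [Tt [Pt Qt xt]]; split; first exact: Tc.
have := x1 t Tt; rewrite xt => h.
by rewrite hornerD hornerN -[P.[t]](divrK (hR Qt)) h mul1r subrr.
Qed.

Lemma germ_neq0 x w : germ x w -> central_ae [set t | x t != 0].
Proof.
move=> [P [Q [_ _ _ h]]]; apply: sub_central_ae h => t ct [Pt Qt xt].
by rewrite /= xt divring_mulf_neq0 ?invr_neq0.
Qed.

End Germs.

(** * Tangent operators of an almost subnormal series *)

Lemma pigeonhole_fiber n k (u : 'I_(k * n).+1 -> 'I_k) :
  exists c, (n < #|[set j | u j == c]%SET|)%N.
Proof.
apply: contrapT => /forallNP nc; have := card_ord (k * n).+1.
rewrite -sum1_card (partition_big u xpredT)//= => e.
suff : (\sum_(c < k) \sum_(j < (k * n).+1 | u j == c) 1 <= \sum_(c < k) n)%N.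
  by rewrite e sum_nat_const card_ord ltnn.
apply: leq_sum => c _; have /negP := nc c; rewrite -leqNgt -sum1_card.
by under eq_bigl do rewrite inE.
Qed.

Section Chains.
Variables (R : unitRingType) (hR : division_ring R).
Implicit Types (x y a g t : R) (T : set R) (l : seq R).

Definition normal_step (H K : set R) := forall a g, K a -> H g -> K (g * a * g^-1).

(** Finite index as a finite colouring: the form in which the pigeonhole principle applies, and
    which restricts at once to subrings. *)
Definition finite_step (H K : set R) := exists k (u : R -> 'I_k),
  forall x y, H x -> H y -> u x = u y -> K (x / y).

Record subgroup_chain r (H : nat -> set R) : Prop := SubgroupChain {
  chain0 : forall x, x != 0 -> H 0%N x;
  chain_neq0 : forall i x, (i <= r)%N -> H i x -> x != 0;
  chain_div : forall i x y, (i <= r)%N -> H i x -> H i y -> H i (x / y);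
  chain_sub : forall i, (i < r)%N -> H i.+1 `<=` H i;
  chain_step : forall i, (i < r)%N ->
    normal_step (H i) (H i.+1) \/ finite_step (H i) (H i.+1) }.

Variables (r : nat) (H : nat -> set R) (hH : subgroup_chain r H).

(** First order term of [x * a * x^-1 * a^-1] along a curve [x = 1 + t * y + ...]. *)
Definition phi a y := y - a * y * a^-1.

Definition op l y := foldr phi y l.

(* [op l] is the first order term of a rational map into [H i]. *)
Inductive tangent : nat -> seq R -> Prop :=
| tangent0 : tangent 0 [::]
| tangent_normal i l a : normal_step (H i) (H i.+1) -> H i.+1 a -> tangent i l ->
    tangent i.+1 (a :: l)
| tangent_finite i l : finite_step (H i) (H i.+1) -> tangent i l -> tangent i.+1 l.

Lemma op_conj l g y : g != 0 ->
  op [seq g * a * g^-1 | a <- l] (g * y * g^-1) = g * op l y * g^-1.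
Proof.
move=> g0; have gu := hR g0; elim: l => [//|a l IH] /=.
rewrite IH /phi mulrBr mulrBl; congr (_ - _).
have [->|a0] := eqVneq a 0; first by rewrite !(mul0r, mulr0).
have au := hR a0.
have u : g * a * g^-1 \is a GRing.unit.
  by rewrite hR// !divring_mulf_neq0// invr_neq0.
by apply: (mulIr u); rewrite divrK// !mulrA !(divrK gu) divrK.
Qed.

(** An entry added on passing from [i] to [i + 1] lies in [H i.+1], which is normalised by [H i];
    hence the predecessor in [H i.-1]. *)
Lemma tangent_conj i l g : (i <= r)%N -> tangent i l -> H i.-1 g ->
  tangent i [seq g * a * g^-1 | a <- l].
Proof.
move=> + hl; elim: hl g => [|{}i {}l a st Ha _ IH|{}i {}l st _ IH] g ir Hg /=.
- exact: tangent0.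
- apply: tangent_normal => //; first exact: st.
  apply: IH; first exact: ltnW.
  by case: i ir Hg {st Ha} => //= i ir; apply: (chain_sub hH); rewrite ltnW.
- apply: tangent_finite => //; apply: IH; first exact: ltnW.
  by case: i ir Hg {st} => //= i ir; apply: (chain_sub hH); rewrite ltnW.
Qed.

Lemma centralB x y : central x -> central y -> central (x - y).
Proof. by move=> cx cy z; rewrite mulrBr mulrBl cx cy. Qed.

Lemma phi_central a y x : central x -> phi a (x * y) = x * phi a y.
Proof. by move=> cx; rewrite /phi mulrBr !mulrA cx. Qed.

Lemma central_ae_forall n (K : nat -> set R) : (forall j, (j < n)%N -> central_ae (K j)) ->
  central_ae [set t | forall j, (j < n)%N -> K j t].
Proof.
elim: n => [|n IH] hK.
  by apply: (@sub_finite_set _ _ set0) (finite_set0 _) => t [ct]; apply.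
apply: sub_central_ae (central_aeI (IH _) (hK n (ltnSn n))) => [t ct [Kt Kn] j|j jn].
  by rewrite ltnS leq_eqVlt => /orP[/eqP->//|/Kt].
exact/hK/ltnW.
Qed.

(** Several curves with one [y] and distinct central multipliers are carried along, because a step
    of finite index consumes curves. To get [n] of them past a step with [k] colours, take
    [k * n + 1] before it: their colours are constant on an infinite set of parameters, some [n + 1]
    share a colour, and [n] of these divided by the remaining one land in the subgroup. The
    multipliers stay distinct. *)
Lemma tangent_germs i l : (i <= r)%N -> tangent i l ->
  forall y T n, infinite_set T -> T `<=` central ->
  exists T' (x : nat -> R -> R) (c : nat -> R),
  [/\ infinite_set T', T' `<=` T,
    forall j, (j < n)%N -> [/\ central (c j), germ (x j) (c j * op l y) &
      forall t, T' t -> H i (x j t)] &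
    forall j k, (j < n)%N -> (k < n)%N -> c j = c k -> j = k].
Proof.
move=> + hl; elim: hl => [|{}i {}l a st Ha _ IH|{}i {}l st _ IH] ir y T n Ti Tc.
(* At level 0 the multipliers are distinct elements of the parameter set [T] itself. *)
- have [B BT sB] := infinite_set_fset n Ti.
  pose s : seq R := finmap.enum_fset B.
  have sT j : (j < n)%N -> T (nth 0 s j).
    by move=> jn; apply: BT; apply: (mem_nth 0 (leq_trans jn sB : (j < size s)%N)).
  pose x j t := 1 + nth 0 s j * y * t.
  have xg j : germ (x j) (nth 0 s j * y) by exact: germ_line.
  exists [set t | T t /\ forall j, (j < n)%N -> x j t != 0], x, (nth 0 s).
  split=> [|t []//|j jn|j k jn kn /eqP].
  + apply: infinite_central_ae => //; apply: (central_ae_forall (K := fun j t => x j t != 0)) => j _.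
    exact: germ_neq0 (xg j).
  + split=> [||t [Tt xt]]; [exact/Tc/sT|exact: xg|].
    by apply: (chain0 hH); exact: xt.
  + by rewrite nth_uniq ?(leq_trans jn)// ?(leq_trans kn)// ?finmap.fset_uniq// => /eqP.
- have [T' [x [c [T'i T'T hx ci]]]] := IH (ltnW ir) y T n Ti Tc.
  exists T', (fun j t => x j t * a * (x j t)^-1 * a^-1), c; split=> // j jn.
  have [cj xg Hx] := hx j jn; split=> // [|t T't]; last first.
    by apply: (chain_div hH) => //; apply: st => //; exact: Hx.
  by rewrite -phi_central//; apply: germ_comm => //; apply: (chain_neq0 hH ir Ha).
- have [k [u uH]] := st.
  have [T' [x [c [T'i T'T hx ci]]]] := IH (ltnW ir) y T (k * n).+1 Ti Tc.
  pose pat t := [ffun j : 'I_(k * n).+1 => u (x j t)].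
  have [v vi] := infinite_fiber (f := pat) T'i (finite_finpred (@predT {ffun 'I_(k * n).+1 -> 'I_k})) (fun _ _ => isT).
  have [d dn] := pigeonhole_fiber v.
  pose s := enum [set j | v j == d]%SET.
  have sn : (n < size s)%N by rewrite /s -cardE.
  pose j0 : 'I_(k * n).+1 := ord0; pose f j := nth j0 s j.
  have fE j : (j < size s)%N -> v (f j) = d.
    by move=> jn; have := mem_nth j0 jn; rewrite mem_enum inE => /eqP.
  exists [set t | T' t /\ pat t = v], (fun j t => x (f j.+1) t / x (f 0%N) t),
    (fun j => c (f j.+1) - c (f 0%N)); split=> [//|t [/T'T]//|j jn|j m jn mn /addIr e].
  + have jn' : (j.+1 < size s)%N by exact: leq_ltn_trans sn.
    have [cj xg Hx] := hx _ (ltn_ord (f j.+1)).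
    have [c0 xg0 Hx0] := hx _ (ltn_ord (f 0%N)).
    split=> [||t [T't pt]]; [exact: centralB|by rewrite mulrBl; exact: germ_div|].
    apply: uH; [exact: Hx|exact: Hx0|].
    have pj m : u (x (f m) t) = v (f m) by rewrite -pt ffunE.
    by rewrite !pj !fE// (leq_ltn_trans _ sn).
  + have /val_inj/eqP := ci _ _ (ltn_ord _) (ltn_ord _) e.
    by rewrite nth_uniq ?enum_uniq// ?(leq_ltn_trans _ sn)// => /eqP[].
Qed.

Lemma tangent_germ i l y T : (i <= r)%N -> tangent i l ->
  infinite_set T -> T `<=` central ->
  exists T' (x : R -> R) c, [/\ infinite_set T', T' `<=` T, central c /\ c != 0,
    germ x (c * op l y) & forall t, T' t -> H i (x t)].
Proof.
(* Of two distinct multipliers one is nonzero. *)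
move=> ir hl Ti Tc; have [T' [x [c [T'i T'T hx ci]]]] := tangent_germs ir hl y 2 Ti Tc.
have [j j2 cj] : exists2 j, (j < 2)%N & c j != 0.
  have [c0|c0] := eqVneq (c 0%N) 0; last by exists 0%N.
  exists 1%N => //; apply/eqP => c1.
  by have := ci 0%N 1%N erefl erefl; rewrite c0 c1 => /(_ erefl).
by have [cc xg Hx] := hx j j2; exists T', (x j), (c j).
Qed.

End Chains.

(** * Infinite center *)

Section AlgebraicDegree.
Variables (F : fieldType) (D : unitAlgType F).
Hypotheses (hD : division_ring D) (hF : has_center D).
Implicit Types (x w t : D) (T : set D).

Definition degree_le d x :=
  exists q : {poly F}, [/\ q != 0, (size q <= d.+1)%N & horner_alg x q = 0].

Lemma horner_alg_sum x n (q : {poly F}) : (size q <= n)%N ->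
  horner_alg x q = \sum_(i < n) q`_i *: x ^+ i.
Proof.
move=> sq; rewrite {1}(_ : q = \poly_(i < n) q`_i).
  rewrite poly_def linear_sum; apply: eq_bigr => i _.
  by rewrite linearZ/= rmorphXn/= horner_algX mulr_algl.
apply/polyP => i; rewrite coef_poly; case: ltnP => // h.
by rewrite nth_default// (leq_trans sq).
Qed.

Lemma horner_alg_comp x (q p : {poly F}) :
  horner_alg x (q \Po p) = horner_alg (horner_alg x p) q.
Proof.
elim/poly_ind: q => [|q c IH]; first by rewrite comp_poly0 !rmorph0.
by rewrite comp_poly_MXaddC !rmorphD !rmorphM/= IH horner_algX !horner_algC.
Qed.

Lemma degree_le_not_free d x : degree_le d x -> ~ free_family d.+1 (fun i => x ^+ i : D).
Proof.
move=> [q [q0 sq qx]]; rewrite (horner_alg_sum x sq) in qx => /(_ _ qx) q_eq0.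
move/eqP: q0; apply; apply/polyP => i; rewrite coef0.
by have [/q_eq0//|h] := ltnP i d.+1; rewrite nth_default// (leq_trans sq).
Qed.

Lemma degree_le_affine d x (s c : F) : s != 0 ->
  degree_le d (s *: x + c%:A) -> degree_le d x.
Proof.
move=> s0 [q [q0 sq qx]]; pose p : {poly F} := s *: 'X + c%:P.
have sp : size p = 2.
  by rewrite /p size_polyDl size_scale ?size_polyX// size_polyC; case: (c != 0).
exists (q \Po p); rewrite size_comp_poly2// sq; split=> //.
  by rewrite -size_poly_eq0 size_comp_poly2// size_poly_eq0.
by rewrite horner_alg_comp rmorphD/= linearZ/= horner_algX horner_algC mulr_algl.
Qed.

Lemma centralE t : central t -> exists s : F, t = s%:A.
Proof. by move=> ct; apply/(hF t).1 => y; rewrite ct. Qed.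

(** Induction on [k]: if [q] serves up to [k] and [p k * B = Q * A], then [q * B] serves up to
    [k + 1], since u^(k+1) q B = u p_k B = u Q A = P A. *)
Lemma common_denominator (u : D -> D) (P Q : {poly D}) w k : Q`_0 = 1 -> P`_0 = w ->
  central_ae [set t | u t * Q.[t] = P.[t]] ->
  exists (p : nat -> {poly D}) (q : {poly D}), [/\ q`_0 = 1,
    forall j, (j <= k)%N -> (p j)`_0 = w ^+ j &
    central_ae [set t | q.[t] != 0 /\
      forall j, (j <= k)%N -> u t ^+ j * q.[t] = (p j).[t]]].
Proof.
move=> Q0 P0 uQP; elim: k => [|k [p [q [q0 p0 hp]]]].
  exists (fun=> 1), 1; rewrite coef1; split=> [//|[]//|].
  apply: (@sub_finite_set _ _ set0) (finite_set0 _) => t [ct]; apply.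
  by split=> [|[]//]; rewrite !hornerC ?oner_neq0// expr0 mulr1.
have [A [B [B0 pB]]] := ore hD (p k) Q0.
have A0 : A`_0 = w ^+ k.
  have := congr1 (fun P : {poly _} => P`_0) pB.
  by rewrite !coefM !big_ord1 B0 Q0 mul1r mulr1 p0.
exists (fun j => if (j <= k)%N then p j * B else P * A), (q * B); split.
- by rewrite coefM big_ord1 q0 B0 mulr1.
- move=> j jk1; case: (leqP j k) => jk; first by rewrite coefM big_ord1 B0 mulr1 p0.
  rewrite (_ : j = k.+1); last by apply/eqP; rewrite eqn_leq jk1.
  by rewrite coefM big_ord1 A0 P0 exprS.
apply: sub_central_ae (central_aeI (central_aeI uQP hp) (central_ae_root_neq0 hD B0)).
move=> t ct [[uQt [qt pt]] Bt]; split=> [|j jk1]; rewrite /= horner_centralM//.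
  exact: divring_mulf_neq0.
case: (leqP j k) => jk; first by rewrite horner_centralM// mulrA pt.
rewrite (_ : j = k.+1); last by apply/eqP; rewrite eqn_leq jk1.
rewrite exprS mulrA -(mulrA (u t)) pt// -mulrA -horner_centralM// pB.
by rewrite !horner_centralM// mulrA uQt.
Qed.

(** [u t = (x t - 1) / t] also has degree at most [d], and as a rational expression it takes the
    value [w] at 0. With functionals [l] dual to the powers of [w], the matrix [M] of the
    [l i (u ^+ j * q)] is singular at infinitely many scalars, so its determinant is the zero
    polynomial; yet at 0 it is the identity. *)
Lemma germ_degree (x : D -> D) w T d : germ x w -> infinite_set T -> T `<=` central ->
  (forall t, T t -> degree_le d (x t)) -> ~ free_family d.+1 (fun i => w ^+ i : D).
Proof.
move=> [P [Q [P0 Q0 wE xPQ]]] Ti Tc xd fr.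
have PQ0 : (P - Q)`_0 = 0 by rewrite coefB P0 Q0 subrr.
have [S SE S0] : exists2 S, P - Q = S * 'X & S`_0 = w.
  have := polyX_factor PQ0; set S := \poly_(i < _) _ => SE; exists S => //.
  by have := congr1 (fun P : {poly _} => P`_1) SE; rewrite coefMX coefB wE.
have ne0 : central_ae [set t : D | t != 0].
  apply: (@sub_finite_set _ _ [set 0]) (finite_set1 _) => t [_ /negP/negPn/eqP//].
pose u t := (x t - 1) * t^-1.
have uQS : central_ae [set t | u t * Q.[t] = S.[t]].
  apply: sub_central_ae (central_aeI xPQ ne0) => t ct [[Pt Qt xt] t0] /=.
  have tu := hD t0; rewrite /u xt.
  apply: (mulIr tu); have <- : (S * 'X).[t] = S.[t] * t by rewrite hornerMX.
  rewrite -SE hornerD hornerN -!mulrA (ct Q.[t]) mulKr// mulrBl mul1r divrK//.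
  exact: hD.
have [p [q [q0 p0 hp]]] := common_denominator d Q0 S0 uQS.
have /choice[l lE] : forall k : 'I_d.+1, exists l : {scalar D},
    forall i, (i < d.+1)%N -> l (w ^+ i) = (i == k)%:R.
  by move=> k; apply: free_family_dual fr (ltn_ord k).
pose M : 'M[{poly F}]_d.+1 := \matrix_(i, j) map_poly (l i) (p j).
have T1 := infinite_central_ae Ti Tc (central_aeI hp (central_aeI ne0 xPQ)).
set T' := [set t | _] in T1.
have T2 : infinite_set [set s : F | T' s%:A].
  move=> /(finite_image (fun s : F => s%:A : D)); apply: contra_not T1.
  apply: sub_finite_set => t T't; have [s sE] := centralE (Tc t T't.1).
  by exists s => //; rewrite /= -sE.
have detM : \det M = 0.
  apply: (infinite_central_roots (R := F) _ T2) => [z z0|s [Ts [[qs ps] [s0 _]]]].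
    by rewrite unitfE.
  split=> [z|]; first exact: mulrC.
  have su : s != 0 by apply: contraNneq s0 => ->; rewrite scale0r.
  (* [x] is [s *: u + 1] at the scalar [s], so [u] inherits the degree bound. *)
  have /degree_le_not_free/not_free_family_ord[c c0 cE] : degree_le d (u s%:A).
    apply: (@degree_le_affine _ _ s 1) => //.
    by rewrite -[s *: u _]mulr_algr /u divrK ?hD// scale1r subrK; exact: xd.
  rewrite -horner_evalE -det_map_mx -det_tr; apply/eqP/det0P; exists c => //.
  apply/rowP => i; rewrite !mxE.
  have : l i ((\sum_(j < d.+1) c 0 j *: u s%:A ^+ j) * q.[s%:A]) = 0.
    by rewrite cE mul0r linear0.
  rewrite mulr_suml linear_sum => h; apply: etrans h; apply: eq_bigr => j _.
  rewrite !mxE/= /horner_eval -horner_functional -scalerAl linearZ/= ps//.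
  by rewrite -ltnS.
have /eqP := congr1 (fun P : {poly _} => P`_0) detM; rewrite coef0 -horner_coef0.
rewrite -horner_evalE -det_map_mx (_ : map_mx _ _ = 1%:M) ?det1 ?oner_eq0//.
apply/matrixP => i j; rewrite !mxE/= /horner_eval horner_coef0 coef_map/=.
rewrite p0; last by rewrite -ltnS.
by rewrite lE ?ltn_ord// eq_sym.
Qed.

Lemma free_powers_scale d w (k : F) : k != 0 ->
  free_family d (fun i => w ^+ i : D) -> free_family d (fun i => (k *: w) ^+ i : D).
Proof.
move=> k0 fr c cE i iln; have := fr (fun i => c i * k ^+ i) _ i iln.
move=> /(_ _)/eqP; rewrite mulf_eq0 (negbTE (expf_neq0 i k0)) orbF => h; apply/eqP/h.
by apply: etrans cE; apply: eq_bigr => j _; rewrite exprZn scalerA.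
Qed.

End AlgebraicDegree.

Section ChainFacts.
Variables (R : unitRingType) (hR : division_ring R).
Variables (r : nat) (H : nat -> set R) (hH : subgroup_chain r H).
Implicit Types (x y e m a : R).

Lemma phi_eq0 a y : a != 0 -> phi a y = 0 -> a * y = y * a.
Proof.
move=> a0 /eqP; rewrite subr_eq0 eq_sym => /eqP h.
exact/(divring_conj_fix hR y a0).
Qed.

Lemma chain_le i j : (i <= j)%N -> (j <= r)%N -> H j `<=` H i.
Proof.
elim: j => [|j IH]; first by rewrite leqn0 => /eqP-> _ x.
rewrite leq_eqVlt => /orP[/eqP-> _ x //|ij] jr; apply: subset_trans (IH ij (ltnW jr)).
exact: (chain_sub hH).
Qed.

Lemma chain1 i x : (i <= r)%N -> H i x -> H i 1.
Proof.
move=> ir Hx; rewrite -(divrr (hR (chain_neq0 hH ir Hx))).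
exact: (chain_div hH).
Qed.

Lemma chainV i x : (i <= r)%N -> H i x -> H i x^-1.
Proof.
by move=> ir Hx; rewrite -div1r; apply: (chain_div hH) => //; exact: chain1 Hx.
Qed.

End ChainFacts.

Section InfiniteCenter.
Variables (F : fieldType) (D : unitAlgType F).
Hypotheses (hD : division_ring D) (hF : has_center D).
Hypothesis infD : ~ finite_rank [set: D].
Hypothesis infF : infinite_set [set: F].
Variables (r : nat) (H : nat -> set D) (hH : subgroup_chain r H).
Implicit Types (x y e m a b : D) (l : seq D).

Let T0 : set D := range (fun s : F => s%:A).

Lemma infinite_scalars : infinite_set T0.
Proof. exact/infinite_image/infF/(fmorph_inj (in_alg D)). Qed.

Lemma scalars_central : T0 `<=` central.
Proof. by move=> _ [s _ <-]; exact: central_scalar. Qed.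

Lemma mulop_op l : mulop (op l).
Proof.
elim: l => [|a l IH]; first exact: mulop_id.
exact/mulopD/mulopN/mulop_lr.
Qed.

Lemma mulop_phi a (f : D -> D) : mulop f -> mulop (fun y => phi a (f y)).
Proof. by move=> fM; apply/mulopD/mulopN/mulop_lr. Qed.

Lemma commV x y : x * y = y * x -> x^-1 * y = y * x^-1.
Proof. by move=> h; apply/esym/commrV. Qed.

(* The elements commuting with all first order terms at level [i + 1] form a
   division algebra of finite dimension normalised by [H i].  By rationality it
   is stable under [phi _ (op l _)] for the operators [op l] at level [i], which
   are therefore of finite rank, hence zero. *)
Lemma centralizer_tangent b i : H r b -> ~ central b -> (i <= r)%N ->
  (exists l y, tangent H i l /\ op l y <> 0) /\
  forall e, (forall l y, tangent H i l -> e * op l y = op l y * e) -> central e.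
Proof.
move=> Hb ncb; elim: i => [_|i IH ir].
  split=> [|e he x]; last by rewrite -(he [::] x) //; exact: tangent0.
  by exists [::], 1; split; [exact: tangent0 | exact/eqP/oner_neq0].
have [[l0 [y0 [tl0 l0y0]]] IHc] := IH (ltnW ir).
have [st|st] := chain_step hH ir; last first.
  split; first by exists l0, y0; split=> //; exact: tangent_finite.
  by move=> e he; apply: IHc => l y tl; apply: he; exact: tangent_finite.
have Hib : H i.+1 b by apply: (chain_le hH ir).
have b0 : b != 0 by exact: (chain_neq0 hH ir Hib).
(* By induction only central elements commute with all first order terms at level [i], and [b] is
   not central. *)
have [l1 [y1 [tl1 bl1]]] : exists l y, tangent H i l /\ phi b (op l y) <> 0.
  apply: contrapT => nl; apply: ncb; apply: IHc => l y tl.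
  by apply: (phi_eq0 hD b0); apply: contrapT => h; apply: nl; exists l, y.
split; first by exists (b :: l1), y1; split=> //; exact: tangent_normal.
move=> e he; have [->|e0] := eqVneq e 0; first by move=> x; rewrite mulr0 mul0r.
have eu := hD e0.
have [s sP] := centralizer_image_finite_rank hD hF infD (mulop_op (b :: l1)) (ex_intro _ y1 bl1).
apply: IHc => l y tl; apply: (phi_eq0 hD e0).
apply: (mulop_finite_rank_eq0 hD hF infD (s := s) (mulop_phi e (mulop_op l))) => {}y.
(* The values of [phi e (op l _)] then commute with those of [op (b :: l1)], so they lie in the span
   of [s]. *)
suff key l' y' : tangent H i.+1 l' ->
    phi e (op l y) * op l' y' = op l' y' * phi e (op l y).
  by apply: sP => z; apply: key; exact: tangent_normal.
move=> tl'; set m := op l' y'; have [->|m0] := eqVneq m 0; first by rewrite mulr0 mul0r.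
have [T' [x [c [T'i T'T [cc c0] xg Hx]]]] :=
  tangent_germ hD hH y (ltnW ir) tl infinite_scalars scalars_central.
have T'c : T' `<=` central := subset_trans T'T scalars_central.
(* Commutators with [m] of the commutators of [x t] with [e]: this curve turns out to be constantly
   1. *)
have x1g := germ_comm hD m0 (germ_comm hD e0 xg).
rewrite -/(phi e _) -/(phi m _) !phi_central// in x1g.
have : c * phi m (phi e (op l y)) = 0.
  apply: (germ_eq1 hD x1g T'i T'c) => t T't.
  have xt0 : x t != 0 := chain_neq0 hH (ltnW ir) (Hx t T't).
  have xu := hD xt0.
  (* [(x t)^-1 * m * x t] is again a first order term at level [i + 1], so [e] commutes with it;
     conjugate back by [x t]. *)
  have hc : x t * e * (x t)^-1 * m = m * (x t * e * (x t)^-1).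
    have := op_conj hD l' y' (invr_neq0 xt0); rewrite invrK -/m => mE.
    have := he _ ((x t)^-1 * y' * x t) (tangent_conj hH ir tl' (chainV hD hH (ltnW ir) (Hx t T't))).
    rewrite invrK mE => h.
    apply: (mulrI (hD (invr_neq0 xt0))); apply: (mulIr xu).
    have -> : (x t)^-1 * (x t * e * (x t)^-1 * m) * x t = e * ((x t)^-1 * m * x t).
      by rewrite -!mulrA mulKr.
    by rewrite h !mulrA divrK.
  have hem : e^-1 * m = m * e^-1 by apply: commV; exact: he.
  set z := x t * e * (x t)^-1 in hc *.
  have hz : z * e^-1 * m = m * (z * e^-1) by rewrite -(mulrA z) hem mulrA hc mulrA.
  have zu : z * e^-1 \is a GRing.unit.
    by rewrite hD// /z !divring_mulf_neq0// invr_neq0.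
  by rewrite hz mulrK// divrr// hD.
move/eqP; rewrite divring_mulf_eq0// (negbTE c0)/= => /eqP/(phi_eq0 hD m0).
by move=> ->.
Qed.

(** As [b] is not central, some [phi b (op l _)] with [l] at level [r] is nonzero. Its values are,
    up to nonzero scalars, first order terms of curves of commutators, hence of degree at most [d];
    but a nonzero operator takes values of larger degree. *)
Lemma infinite_center_contra d :
  (exists x y, [/\ H r x, H r y & x * y <> y * x]) ->
  (forall x y, H r x -> H r y -> degree_le d (x * y * x^-1 * y^-1)) -> False.
Proof.
move=> [b [b' [Hb Hb' nbb']]] hd.
have ncb : ~ central b by move=> cb; apply: nbb'; rewrite cb.
have b0 : b != 0 by exact: (chain_neq0 hH (leqnn r) Hb).
have [_ hc] := centralizer_tangent Hb ncb (leqnn r).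
have [l [y1 [tl nz]]] : exists l y, tangent H r l /\ phi b (op l y) <> 0.
  apply: contrapT => nl; apply: ncb; apply: hc => l y tl.
  by apply: (phi_eq0 hD b0); apply: contrapT => h; apply: nl; exists l, y.
have [y fr] := mulop_unbounded_degree hD hF infD infF d
  (mulop_op (b :: l)) (ex_intro _ y1 nz).
have [T' [x [c [T'i T'T [cc c0] xg Hx]]]] :=
  tangent_germ hD hH y (leqnn r) tl infinite_scalars scalars_central.
have T'c : T' `<=` central := subset_trans T'T scalars_central.
have x1g := germ_comm hD b0 xg.
apply: (germ_degree hD hF x1g T'i T'c) => [t T't|]; first by apply: hd => //; exact: Hx.
rewrite -/(phi b _) phi_central//.
have [k kE] := centralE hF cc; rewrite kE mulr_algl.
by apply: free_powers_scale => //; apply: contraNneq c0 => k0; rewrite kE k0 scale0r.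
Qed.

End InfiniteCenter.

(** * Finite center *)

Section DivisionSubring.
Variables (D : unitRingType) (S : divringClosed D).

Record subdivring := Subdivring { subdivring_val :> D; _ : subdivring_val \in S }.

HB.instance Definition _ := [isSub for subdivring_val].
HB.instance Definition _ := [Choice of subdivring by <:].
HB.instance Definition _ := [SubChoice_isSubUnitRing of subdivring by <:].

Lemma subdivring_division : division_ring D -> division_ring subdivring.
Proof.
move=> hD x x0; have vx : val x != 0 by apply: contra_neq x0 => h; apply: val_inj.
have vxS : (val x)^-1 \in S by rewrite rpredV (valP x).
apply/unitrP; exists (Sub (val x)^-1 vxS : subdivring).
by split; apply/val_inj; rewrite !rmorphM rmorph1/= ?SubK ?mulVr ?mulrV// hD.
Qed.

Lemma subdivringM (x y : subdivring) : 
  subdivring_val (x * y) = subdivring_val x * subdivring_val y.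
Proof. exact: (rmorphM val x y). Qed.

Lemma subdivringX (x : subdivring) n : subdivring_val (x ^+ n) = subdivring_val x ^+ n.
Proof. exact: (rmorphXn val n x). Qed.

Lemma subdivringV (x : subdivring) : division_ring D ->
  subdivring_val x^-1 = (subdivring_val x)^-1.
Proof.
move=> hD; have [->|x0] := eqVneq x 0; first by rewrite invr0 [subdivring_val 0](rmorph0 val) invr0.
by apply: (rmorphV val); exact: subdivring_division.
Qed.

Section Wedderburn.
Variable s : seq D.
Hypotheses (hD : division_ring D) (sS : forall x, x \in S -> x \in s).

Let unpickle_sub n : option subdivring := insub (nth 0 s n).

Let pickle_subK : pcancel (fun x : subdivring => index (val x) s) unpickle_sub.
Proof. by move=> x; rewrite /unpickle_sub nth_index ?valK//; apply/sS/valP. Qed.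

HB.instance Definition _ := PCanIsCountable pickle_subK.

Let enum_sub : seq subdivring := pmap insub (undup s).

Let enum_subP : Finite.axiom enum_sub.
Proof.
apply: Finite.uniq_enumP; first by rewrite pmap_sub_uniq ?undup_uniq.
by move=> x; rewrite mem_pmap_sub mem_undup sS ?(valP x).
Qed.

HB.instance Definition _ := isFinite.Build subdivring enum_subP.

Lemma finite_subdivring_comm x y : x \in S -> y \in S -> x * y = y * x.
Proof.
move=> xS yS; have dom : GRing.integral_domain_axiom subdivring.
  move=> u v /eqP; rewrite divring_mulf_eq0 => [/orP//|].
  exact: subdivring_division.
have := @finDomain_mulrC subdivring dom (Sub x xS) (Sub y yS).
by move=> /(congr1 val); rewrite !rmorphM.
Qed.

End Wedderburn.

End DivisionSubring.

Section TorsionCommutators.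
Variables (R : unitRingType) (hR : division_ring R).
Variables (r : nat) (H : nat -> set R) (hH : subgroup_chain r H).
Implicit Types (x y a g : R) (T : set R).

(** A normal step contributes a factor [phi a], a step of finite index none. *)
Lemma tangent_nseq i a : (i <= r)%N -> H r a -> exists k, tangent H i (nseq k a).
Proof.
move=> + Ha; elim: i => [_|i IH ir]; first by exists 0%N; exact: tangent0.
have [k tk] := IH (ltnW ir); have [st|st] := chain_step hH ir.
  exists k.+1; apply: tangent_normal => //; exact: (chain_le hH ir (leqnn r)).
by exists k; exact: tangent_finite.
Qed.

(* As [phi a] acts on [y] by [1 - g], the commutators of [a] with a curve have the
   form [1 + t v + ...] with [e v <> 0]. *)
Lemma torsion_commutators_contra T a y g e : infinite_set T -> T `<=` central ->
  H r a -> y != 0 -> a * y = g * y * a -> g * a = a * g -> g != 1 -> e%:R != 0 :> R ->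
  (forall x, H r x -> (x * a * x^-1 * a^-1) ^+ e = 1) -> False.
Proof.
move=> Ti Tc Ha y0 ay ga g1 e0 he.
have a0 : a != 0 := chain_neq0 hH (leqnn r) Ha.
have phiE k : phi a ((1 - g) ^+ k * y) = (1 - g) ^+ k.+1 * y.
  have cg : a * (1 - g) ^+ k = (1 - g) ^+ k * a.
    by apply/commrX; rewrite /GRing.comm mulrBr mulrBl ga mulr1 mul1r.
  rewrite /phi (mulrA a) cg -(mulrA _ a) ay !mulrA mulrK ?hR// -!mulrA -mulrBr.
  by rewrite -[X in _ * (X - _)]mul1r -mulrBl mulrA -exprSr.
have opE k : op (nseq k a) y = (1 - g) ^+ k * y.
  by elim: k => [|k IH] /=; rewrite ?mul1r// IH phiE.
have [k tk] := tangent_nseq (leqnn r) Ha.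
have [T' [x [c [T'i T'T [cc c0] xg Hx]]]] := tangent_germ hR hH y (leqnn r) tk Ti Tc.
have xge := germX hR e (germ_comm hR a0 xg).
have := germ_eq1 hR xge T'i (subset_trans T'T Tc) (fun t T't => he _ (Hx t T't)).
rewrite -/(phi a _) phi_central// opE phiE -mulr_natr => /eqP.
rewrite !divring_mulf_eq0// (negbTE c0) (negbTE e0) (negbTE y0) !orbF/=.
apply/negP; elim: k.+1 => [|j IH]; first by rewrite expr0 oner_eq0.
by rewrite exprS divring_mulf_neq0// subr_eq0 eq_sym.
Qed.

End TorsionCommutators.

Lemma infinite_nat_pair (U : Type) (B : set U) (f : nat -> U) : finite_set B ->
  (forall n, B (f n)) -> exists i j, (i < j)%N /\ f i = f j.
Proof.
move=> Bf fB; have [u ui] := infinite_fiber infinite_nat Bf (fun n _ => fB n).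
have [C Cs sC] := infinite_set_fset 2 ui.
pose s : seq nat := finmap.enum_fset C.
have us : uniq s := finmap.fset_uniq C.
have su n : n \in s -> f n = u by move=> /Cs[].
have {sC} : (1 < size s)%N := sC.
case: s us su => [|m [|n s]] // us su _.
move: us => /= /andP[]; rewrite inE negb_or => /andP[mn _] _.
have [fm fn] : f m = u /\ f n = u by split; apply: su; rewrite !inE eqxx ?orbT.
by move: mn; rewrite neq_ltn => /orP[mn|nm]; [exists m, n | exists n, m]; rewrite fm fn.
Qed.

(** * Bounded degree over a finite field forces torsion *)

Section FiniteCenter.
Variables (F : fieldType) (D : unitAlgType F).
Hypothesis hD : division_ring D.
Hypothesis finF : finite_set [set: F].
Implicit Types (x y a : D) (f : F).

Lemma finite_lspan (s : seq D) : finite_set (lspan s).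
Proof.
elim: s => [|v s IH].
  by apply: (@sub_finite_set _ _ [set 0]) (finite_set1 _) => x; case.
apply: sub_finite_set (finite_image2 (fun c u => c *: v + u) finF IH) => x.
elim=> [|c w z]; first by exists 0 => //; exists 0; rewrite ?scale0r ?addr0//; exact: lspan0.
rewrite inE => /orP[/eqP->|ws] _ [d _ [u su <-]].
  by exists (c + d) => //; exists u => //; rewrite scalerDl addrA.
by exists d => //; exists (c *: w + u); [exact: lspan_cons | rewrite addrCA].
Qed.

Lemma exists_pchar : exists p, p \in [pchar D].
Proof.
have [i [j [ij e]]] := infinite_nat_pair (f := fun n => n%:R : F) finF (fun _ => I).
have [p pF] : exists p, p \in [pchar F].
  apply: (@natf0_pchar _ (j - i)); first by rewrite subn_gt0.
  by rewrite natrB ?(ltnW ij)// e subrr.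
by exists p; apply: (rmorph_pchar (in_alg D)).
Qed.

Lemma finite_poly n : finite_set [set q : {poly F} | (size q <= n)%N].
Proof.
elim: n => [|n IH].
  by apply: (@sub_finite_set _ _ [set 0]) (finite_set1 _) => q /=; rewrite leqn0 size_poly_eq0 => /eqP.
apply: sub_finite_set (finite_image2 (fun c (q : {poly F}) => q * 'X + c%:P) finF IH) => q /=.
elim/poly_ind: q => [|q c _] sq.
  by exists 0 => //; exists 0; rewrite ?size_poly0// mul0r add0r.
exists c => //; exists q => //=; move: sq; rewrite size_MXaddC.
by case: ifP => [/andP[/eqP->]|//]; rewrite size_poly0.
Qed.

(** The remainders of the ['X^k] modulo [q] lie in a finite set, so two coincide; the exponent
    depends on [q] only. *)
Lemma poly_root_torsion (q : {poly F}) : q != 0 ->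
  exists2 e, (0 < e)%N & forall x, x != 0 -> horner_alg x q = 0 -> x ^+ e = 1.
Proof.
move=> q0; have [i [j [ij qij]]] := infinite_nat_pair (f := fun k => 'X^k %% q)
  (finite_poly (size q)) (fun k => ltnW (ltn_modpN0 _ q0)).
exists (j - i)%N => [|x x0 xq]; first by rewrite subn_gt0.
have modE k : horner_alg x ('X^k %% q) = x ^+ k.
  rewrite -[RHS]/(x ^+ k) -{2}(horner_algX x) -rmorphXn/= {2}(divp_eq 'X^k q).
  by rewrite rmorphD rmorphM/= xq mulr0 add0r.
apply: (mulrI (unitrX i (hD x0))); rewrite -exprD subnKC ?(ltnW ij)// mulr1.
by rewrite -!modE qij.
Qed.

(** There are finitely many polynomials of size at most [d.+1] over a finite field; multiply their
    exponents. *)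
Lemma degree_le_torsion d :
  exists2 e, (0 < e)%N & forall x, x != 0 -> degree_le d x -> x ^+ e = 1.
Proof.
have /finite_seqP[s sE] := finite_poly d.+1.
have /choice[e he] : forall q : {poly F}, exists e, (0 < e)%N /\
    (q != 0 -> forall x, x != 0 -> horner_alg x q = 0 -> x ^+ e = 1).
  move=> q; have [->|/poly_root_torsion[e e0 h]] := eqVneq q 0; first by exists 1%N.
  by exists e.
exists (\prod_(q <- s) e q)%N; first by rewrite prodn_gt0// => q; have [] := he q.
move=> x x0 [q [q0 sq qx]]; have qs : q \in s.
  by have : [set q : {poly F} | (size q <= d.+1)%N] q by []; rewrite sE.
by rewrite (big_rem q)//= exprM (he q).2// expr1n.
Qed.

(* Frobenius is injective. *)
Lemma torsion_pchar E : (0 < E)%N -> exists2 e, e%:R != 0 :> D &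
  forall x, x ^+ E = 1 -> x ^+ e = 1.
Proof.
move=> E0; have [p pD] := exists_pchar; have pp := pcharf_prime pD.
have [e ce EE] := pfactor_coprime pp E0; exists e.
  by rewrite -(dvdn_pcharf pD) -prime_coprime.
move=> x; rewrite EE exprM; elim: (logn p E) => [|k IH]; first by rewrite expr1.
rewrite expnSr exprM => h; apply: IH; move: (_ ^+ (p ^ k)) h => z zp.
have := pFrobenius_autB_comm pD (commr1 z); rewrite pFrobenius_aut1 !pFrobenius_autE zp.
rewrite subrr => /eqP h.
apply/eqP; rewrite -subr_eq0; move: h; elim: p {pD pp ce EE zp} => [|n IHn].
  by rewrite expr0 oner_eq0.
by rewrite exprS divring_mulf_eq0// => /orP[//|/IHn].
Qed.

End FiniteCenter.

(** * Elements that commute up to a scalar and a power *)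

Section SkewPairs.
Variables (F : fieldType) (D : unitAlgType F).
Hypothesis hD : division_ring D.
Hypothesis finF : finite_set [set: F].
Implicit Types (x y a : D) (f : F).

(** The span of the monomials [a ^+ i * y ^+ k] is finite, closed under products by the skew
    relation and under inverses because powers repeat. So it is a finite division ring, commutative
    by Wedderburn's theorem. *)
Lemma skew_pair_torsion_comm a y f j m n : (0 < m)%N -> (0 < n)%N ->
  a ^+ m = 1 -> y ^+ n = 1 -> y * a = f *: (a ^+ j * y) -> a * y = y * a.
Proof.
move=> m0 n0 am yn ya.
pose s := [seq a ^+ i * y ^+ k | i <- iota 0 m, k <- iota 0 n].
have mon i k : lspan s (a ^+ i * y ^+ k).
  apply: lspan_mem; rewrite -(expr_mod i am) -(expr_mod k yn).
  by apply/allpairsP; exists (i %% m, k %% n)%N; rewrite !mem_iota !add0n !ltn_mod m0 n0.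
have yai i : exists g l, y * a ^+ i = g *: (a ^+ l * y).
  elim: i => [|i [g [l e]]]; first by exists 1, 0%N; rewrite scale1r mulr1 mul1r.
  exists (f * g), (l + j)%N; rewrite exprSr mulrA e -scalerAl -mulrA ya.
  by rewrite -scalerAr scalerA mulrC mulrA exprD.
have ykai k i : exists g l, y ^+ k * a ^+ i = g *: (a ^+ l * y ^+ k).
  elim: k => [|k [g [l e]]]; first by exists 1, i; rewrite scale1r mulr1 mul1r.
  have [g' [l' e']] := yai l; exists (g * g'), l'.
  have -> : y ^+ k.+1 * a ^+ i = y * (y ^+ k * a ^+ i) by rewrite exprS mulrA.
  by rewrite e -scalerAr mulrA e' -scalerAl scalerA -mulrA -exprS.
have mulS u v : lspan s u -> lspan s v -> lspan s (u * v).
  move=> su sv; elim: su => [|c w z ws _ IH]; first by rewrite mul0r; exact: lspan0.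
  rewrite mulrDl -scalerAl; apply: lspanD IH; apply: lspanZ.
  elim: sv => [|d w' z' ws' _ IH]; first by rewrite mulr0; exact: lspan0.
  rewrite mulrDr -scalerAr; apply: lspanD IH; apply: lspanZ.
  have /allpairsP[[i k] [_ _ ->]] := ws; have /allpairsP[[i' k'] [_ _ ->]] := ws' => /=.
  have [g [l e]] := ykai k i'.
  rewrite -mulrA (mulrA (y ^+ k)) e -scalerAl -scalerAr; apply: lspanZ.
  by rewrite -(mulrA _ (y ^+ k)) -exprD mulrA -exprD.
have span1 : lspan s 1 by have := mon 0%N 0%N; rewrite !expr0 mulr1.
have spanX u k : lspan s u -> lspan s (u ^+ k).
  by move=> su; elim: k => [|k IH]; rewrite ?expr0// exprS; exact: mulS.
have spanV u : lspan s u -> lspan s u^-1.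
  move=> su; have [->|u0] := eqVneq u 0; first by rewrite invr0; exact: lspan0.
  have [i [k [ik e]]] := infinite_nat_pair (finite_lspan finF s) (fun k => spanX u k su).
  have uu := hD u0.
  suff -> : u^-1 = u ^+ (k - i).-1 by exact: spanX.
  apply: (mulrI (unitrX i.+1 uu)); rewrite exprSr mulrK// -exprSr -exprD e; congr (_ ^+ _).
  by rewrite addSnnS prednK ?subn_gt0// subnKC// ltnW.
pose S : {pred D} := fun x => `[< lspan s x >].
have SP x : reflect (lspan s x) (x \in S) by exact: asboolP.
have hS : divring_closed S.
  split=> [|u v /SP su /SP sv|u v /SP su /SP sv]; first exact/SP.
    exact/SP/lspanB.
  exact/SP/mulS/spanV.
have /finite_seqP[t tE] := finite_lspan finF s.
pose S' : divringClosed D := HB.pack S (GRing.isDivringClosed.Build D S hS).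
apply: (@finite_subdivring_comm D S' t hD).
- by move=> x /SP; rewrite tE.
- by apply/SP; have := mon 1%N 0%N; rewrite expr1 mulr1.
- by apply/SP; have := mon 0%N 1%N; rewrite expr1 mul1r.
Qed.

(* A component of [x] for the action [x |-> a^-1 x a] of the cyclic group of
   order [m]. *)
Lemma skew_eigenvector a x m : (0 < m)%N -> a ^+ m = 1 ->
  (forall i, (0 < i < m)%N -> a ^+ i != 1) -> m%:R != 0 :> D -> a * x <> x * a ->
  exists j y, y * a = a ^+ j * y /\ a * y <> y * a.
Proof.
case: m => // m _ am amin m0 ax.
have au : a \is a GRing.unit by apply/unitrP; exists (a ^+ m); rewrite -exprS -exprSr.
have bm : a^-1 ^+ m.+1 = 1 by rewrite exprVn am invr1.
(* Averages of the conjugates of [x] under powers of [a], where powers of [a] itself act as the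
   roots of unity. *)
pose G j i := a^-1 ^+ (i * j) * x * a ^+ i.
pose E j := \sum_(i < m.+1) G j i.
have Ea j : E j * a = a ^+ j * E j.
  have -> : a ^+ j * E j = a ^+ j * \sum_(i < m.+1) G j i.+1.
    congr (_ * _); rewrite /E big_ord_recl big_ord_recr/= addrC; congr (_ + _).
    by rewrite /G mul0n !expr0 exprM bm expr1n am.
  rewrite mulr_suml mulr_sumr; apply: eq_bigr => i _.
  rewrite /G mulSn exprD exprSr !mulrA; congr (_ * _ * _ * _).
  by rewrite [a^-1 ^+ j]exprVn mulrV ?unitrX// mul1r.
(* Summed over [j], the left coefficient of [x * a ^+ i] is a geometric sum in [a^-1 ^+ i], which
   vanishes unless [i = 0]. *)
have sumE : \sum_(j < m.+1) E j = m.+1%:R * x.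
  rewrite exchange_big/= (bigD1 ord0)//= [X in _ + X]big1 ?addr0 => [|i i0].
    under eq_bigr => j _ do rewrite /G mul0n !expr0 mul1r mulr1.
    by rewrite sumr_const card_ord mulr_natl.
  rewrite /G -!mulr_suml; set c := \sum_(j < _) _.
  suff -> : c = 0 by rewrite !mul0r.
  have ci : a^-1 ^+ i - 1 != 0.
    rewrite subr_eq0 exprVn invr_eq1 amin// lt0n ltn_ord andbT.
    by apply: contraNneq i0 => iE; apply/eqP/val_inj.
  have : (a^-1 ^+ i - 1) * c = 0.
    rewrite /c; under eq_bigr do rewrite exprM.
    by rewrite -subrX1 -exprM mulnC exprM bm expr1n subrr.
  by move/eqP; rewrite divring_mulf_eq0// (negbTE ci) => /eqP.
have [j nj] : exists j, a * E j <> E j * a.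
  apply: contrapT => /forallNP h; apply: ax.
  have : a * \sum_(j < m.+1) E j = (\sum_(j < m.+1) E j) * a.
    by rewrite mulr_sumr mulr_suml; apply: eq_bigr => j _; apply: contrapT => /h.
  rewrite sumE mulrA (commr_nat a) -!mulrA => h'.
  exact: (mulrI (hD m0)).
by exists j, (E j).
Qed.

End SkewPairs.

Section CentralizerChain.
Variables (D : unitRingType) (hD : division_ring D) (u : D).

Definition commutant : {pred D} := fun x => x * u == u * x.

Lemma commutant_divring : divring_closed commutant.
Proof.
split; rewrite ?/commutant ?unfold_in ?mul1r ?mulr1// => x y; rewrite !unfold_in => /eqP xu /eqP yu.
  by rewrite mulrBl mulrBr xu yu.
by rewrite -mulrA -(commrV (esym yu)) !mulrA xu.
Qed.

HB.instance Definition _ := GRing.isDivringClosed.Build D commutant commutant_divring.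

Let R := subdivring commutant.

Lemma commutant_chain r (H : nat -> set D) : subgroup_chain r H ->
  subgroup_chain r (fun i => [set x : R | H i (subdivring_val x)]).
Proof.
move=> [h0 hn0 hdiv hsub hstep]; have valV (x : R) := subdivringV x hD.
split=> [x x0|i x ir Hx|i x y ir Hx Hy|i ir x|i ir].
- by apply: h0; apply: contra_neq x0 => h; apply: val_inj.
- by apply: contraNneq (hn0 _ _ ir Hx) => ->.
- by rewrite /mkset subdivringM valV; exact: hdiv.
- exact: hsub.
have [st|[k [f st]]] := hstep i ir; [left | right].
  by move=> a g Ha Hg; rewrite /mkset !subdivringM valV; exact: st.
exists k, (fun x : R => f (subdivring_val x)) => x y Hx Hy e.
by rewrite /mkset subdivringM valV; exact: st.
Qed.

(** In the centralizer of [u] the powers of [u] are central and pairwise distinct: they are the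
    infinite set of parameters that a finite [F] cannot provide. *)
Lemma commutant_torsion_contra r (H : nat -> set D) a y e : subgroup_chain r H ->
  (forall k, (0 < k)%N -> u ^+ k != 1) -> u != 0 -> a * u = u * a -> y * u = u * y ->
  H r a -> y != 0 -> a * (a * y * a^-1 * y^-1) = a * y * a^-1 * y^-1 * a -> a * y <> y * a ->
  e%:R != 0 :> D -> (forall x, H r x -> (x * a * x^-1 * a^-1) ^+ e = 1) -> False.
Proof.
move=> hH uinf u0 au yu Ha y0 ga ay e0 he.
have hR : division_ring R := subdivring_division hD.
have valV (x : R) := subdivringV x hD.
have inj (x z : R) : x = z :> D -> x = z by exact: val_inj.
have mem x : x * u = u * x -> x \in commutant by move=> h; apply/eqP.
pose a' : R := Subdivring (mem a au); pose y' : R := Subdivring (mem y yu).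
pose u' : R := Subdivring (mem u erefl).
pose g := a' * y' * a'^-1 * y'^-1.
have a0 : a' != 0.
  by apply: (chain_neq0 (commutant_chain hH) (leqnn r)).
have y'0 : y' != 0 by apply: contra_neq y0 => /(congr1 val).
have gE : g = a * y * a^-1 * y^-1 :> D by rewrite /g !subdivringM !valV.
have ag : a' * y' = g * y' * a' by rewrite /g divrK ?hR// divrK// hR.
move: g gE ag => g gE ag.
apply: (@torsion_commutators_contra R hR r _ (commutant_chain hH)
  (range (fun k => u' ^+ k)) a' y' g e).
- apply: infinite_image infinite_nat => i j; wlog ij : i j / (i <= j)%N.
    by move=> hw e'; have [/hw->//|/ltnW/hw->//] := leqP i j.
  move=> /(congr1 val)/=; rewrite !subdivringX/= => e'; apply/eqP; rewrite eqn_leq ij/= leqNgt.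
  apply/negP => ij'; have := uinf (j - i)%N; rewrite subn_gt0 => /(_ ij')/negP; apply.
  apply/eqP/(mulrI (unitrX i (hD u0))); rewrite -exprD subnKC// mulr1; exact/esym.
- move=> _ [k _ <-] x; apply: inj; rewrite !subdivringM subdivringX/=.
  by apply/commrX/eqP; exact: (valP x).
- exact: Ha.
- exact: y'0.
- exact: ag.
- by apply: inj; rewrite !subdivringM gE -ga.
- apply/eqP => g1; apply: ay.
  by have := congr1 val ag; rewrite g1 mul1r.
- by apply: contra_neq e0 => /(congr1 val); rewrite rmorph_nat rmorph0.
- move=> x Hx; apply: inj; rewrite subdivringX !subdivringM !valV.
  exact: he.
Qed.

End CentralizerChain.

Section FiniteCenterContra.
Variables (F : fieldType) (D : unitAlgType F).
Hypotheses (hD : division_ring D) (hF : has_center D).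
Hypothesis finF : finite_set [set: F].
Variables (r : nat) (H : nat -> set D) (hH : subgroup_chain r H).
Implicit Types (x y a : D).

(** The skew relation makes [a * y * a^-1 * y^-1] a scalar multiple of a power of [a], so it
    commutes with [a]. As [a] and [y] do not commute, one of them has infinite order by
    [skew_pair_torsion_comm], and its power [a ^+ m] or [y ^+ n] centralises both. *)
Lemma skew_pair_contra a y f j m n e : (0 < m)%N -> (0 < n)%N ->
  a ^+ m * y = y * a ^+ m -> y ^+ n * a = a * y ^+ n ->
  y * a = f *: (a ^+ j * y) -> a * y <> y * a -> y != 0 -> H r a ->
  e%:R != 0 :> D -> (forall x, H r x -> (x * a * x^-1 * a^-1) ^+ e = 1) -> False.
Proof.
move=> m0 n0 am yn ya ay y0 Ha e0 he.
have a0 : a != 0 := chain_neq0 hH (leqnn r) Ha.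
have au := hD a0; have yu := hD y0.
have ga : a * (a * y * a^-1 * y^-1) = a * y * a^-1 * y^-1 * a.
  have [f0|f0] := eqVneq f 0.
    by move/eqP: ya; rewrite f0 scale0r divring_mulf_eq0// (negbTE y0) (negbTE a0).
  have -> : a * y * a^-1 = f^-1 *: (a * a^-1 ^+ j * y).
    apply: (mulIr au); rewrite divrK// -scalerAl -(mulrA _ y a) ya -scalerAr scalerA mulVf//.
    by rewrite scale1r mulrA -(mulrA a) exprVn mulVr ?unitrX// mulr1.
  rewrite -!scalerAl mulrK// -scalerAr; congr (_ *: _).
  by apply: commrM; [exact: commr_refl | apply/commrX/commrV/commr_refl].
have [[k k0 ak]|na] := pselect (exists2 k, (0 < k)%N & a ^+ k = 1).
  have [[l l0 yl]|ny] := pselect (exists2 l, (0 < l)%N & y ^+ l = 1).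
    by apply: ay; apply: (skew_pair_torsion_comm hD finF k0 l0 ak yl ya).
  apply: (@commutant_torsion_contra D hD (y ^+ n) r H a y e) => //.
  - move=> k' k'0; apply/eqP => yk; apply: ny; exists (n * k')%N; rewrite ?muln_gt0 ?n0//.
    by rewrite exprM.
  - by apply/eqP => h; have := unitrX n yu; rewrite h unitr0.
  - by apply/commrX.
apply: (@commutant_torsion_contra D hD (a ^+ m) r H a y e) => //.
- move=> k' k'0; apply/eqP => ak; apply: na; exists (m * k')%N; rewrite ?muln_gt0 ?m0//.
  by rewrite exprM.
- by apply/eqP => h; have := unitrX m au; rewrite h unitr0.
- by apply/commrX.
Qed.

(** If all commutators are central, [x] and [y] commute up to a root of unity in [F]. Otherwise take
    a noncentral commutator [a]: [skew_eigenvector] gives a [v] with [v * a = a ^+ j * v] that does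
    not commute with [a]. *)
Lemma finite_center_contra d :
  (exists x y, [/\ H r x, H r y & x * y <> y * x]) ->
  (forall x y, H r x -> H r y -> degree_le d (x * y * x^-1 * y^-1)) -> False.
Proof.
move=> [x [y [Hx Hy xy]]] hd.
have nz z : H r z -> z != 0 := chain_neq0 hH (leqnn r).
have [E E0 hE] := degree_le_torsion hD finF d.
have [e e0 he] := torsion_pchar hD finF E0.
have comm1 z z' : H r z -> H r z' -> (z * z' * z^-1 * z'^-1) ^+ e = 1.
  move=> Hz Hz'; apply/he/hE/hd => //.
  by rewrite !divring_mulf_neq0 ?invr_neq0 ?nz.
have e_gt0 : (0 < e)%N by rewrite lt0n; apply: contraNneq e0 => ->.
have [cc|ncc] := pselect (forall z z', H r z -> H r z' -> central (z * z' * z^-1 * z'^-1)).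
  have [f fE] := centralE hF (cc x y Hx Hy).
  have xyE : x * y = f *: (y * x).
    have xu := hD (nz x Hx); have yu := hD (nz y Hy).
    by rewrite -mulr_algl -fE mulrA divrK// divrK.
  have fe : f ^+ e = 1.
    have := comm1 x y Hx Hy; rewrite fE exprZn expr1n => h.
    by apply: (fmorph_inj (in_alg D)); rewrite /= h scale1r.
  have f0 : f != 0.
    by apply/eqP => f0; move/eqP: fe; rewrite f0 expr0n (gtn_eqF e_gt0) eq_sym oner_eq0.
  have xky k : x ^+ k * y = f ^+ k *: (y * x ^+ k).
    elim: k => [|k IH]; first by rewrite !expr0 scale1r mul1r mulr1.
    have -> : x ^+ k.+1 * y = x * (x ^+ k * y) by rewrite exprS mulrA.
    by rewrite IH -scalerAr mulrA xyE -scalerAl scalerA -exprSr -mulrA -exprS.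
  have xyk k : x * y ^+ k = f ^+ k *: (y ^+ k * x).
    elim: k => [|k IH]; first by rewrite !expr0 scale1r mul1r mulr1.
    have -> : x * y ^+ k.+1 = (x * y ^+ k) * y by rewrite exprSr mulrA.
    by rewrite IH -scalerAl -mulrA xyE -scalerAr scalerA -exprSr mulrA -exprSr.
  apply: (@skew_pair_contra x y f^-1 1 e e e) => //.
  - by rewrite xky fe scale1r.
  - by rewrite xyk fe scale1r.
  - by rewrite expr1 xyE scalerA mulVf// scale1r.
  - exact: nz.
  - by move=> z Hz; exact: comm1.
move/existsNP: ncc => [z /existsNP[z' /not_implyP[Hz /not_implyP[Hz' nc]]]].
set a := z * z' * z^-1 * z'^-1 in nc.
have Ha : H r a.
  have V w : H r w -> H r w^-1 := chainV hD hH (leqnn r).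
  have M w w' : H r w -> H r w' -> H r (w * w').
    by move=> hw /V hw'; rewrite -[w']invrK; exact: (chain_div hH).
  exact: M (M _ _ (M _ _ Hz Hz') (V _ Hz)) (V _ Hz').
have ae : a ^+ e = 1 := comm1 z z' Hz Hz'.
clearbody a; pose P m := (0 < m)%N && (a ^+ m == 1).
have exP : exists m, P m by exists e; rewrite /P e_gt0 ae eqxx.
case: (ex_minnP exP) => m /andP[m0 /eqP am] mmin.
(* The order [m] divides [e], which is nonzero in [D]. *)
have m0D : m%:R != 0 :> D.
  have : (m %| e)%N.
    rewrite /dvdn; apply/negPn/negP => nm.
    have := mmin (e %% m)%N; rewrite /P lt0n nm expr_mod// ae eqxx => /(_ erefl).
    by rewrite leqNgt ltn_mod m0.
  by case/dvdnP => q eq; apply: contraNneq e0 => m00; rewrite eq natrM m00 mulr0.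
have [w aw] : exists w, a * w <> w * a.
  apply: contrapT => /forallNP h; apply: nc => w; apply/esym.
  by apply: contrapT => /h.
have amin i : (0 < i < m)%N -> a ^+ i != 1.
  move=> /andP[i0 im]; apply/negP => ai; have := mmin i; rewrite /P i0 ai => /(_ erefl).
  by rewrite leqNgt im.
have [j [v [va av]]] := skew_eigenvector hD m0 am amin m0D aw.
have v0 : v != 0 by apply/eqP => v0; apply: av; rewrite v0 mulr0 mul0r.
have vka k : v ^+ k * a = a ^+ (j ^ k) * v ^+ k.
  elim: k => [|k IH]; first by rewrite !expr0 mul1r mulr1.
  have vai i : v * a ^+ i = a ^+ (j * i) * v.
    elim: i => [|i IHi]; first by rewrite muln0 !expr0 mul1r mulr1.
    by rewrite exprSr mulrA IHi -mulrA va mulrA -exprD mulnS addnC.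
  have -> : v ^+ k.+1 * a = v * (v ^+ k * a) by rewrite exprS mulrA.
  by rewrite IH mulrA vai -mulrA -exprS expnS.
have aB k : [set` [seq a ^+ i | i <- iota 0 m]] (a ^+ (j ^ k)).
  apply/mapP; exists (j ^ k %% m)%N; last by rewrite expr_mod.
  by rewrite mem_iota add0n ltn_mod m0.
(* From [a ^+ (j ^ i) = a ^+ (j ^ k)] it follows that [v ^+ (k - i)] commutes with [a]. *)
have [i [k [ik aik]]] := infinite_nat_pair (f := fun k => a ^+ (j ^ k))
  (finite_seq [seq a ^+ i | i <- iota 0 m])
  aB.
apply: (@skew_pair_contra a v 1 j m (k - i) e) => //.
- by rewrite subn_gt0.
- by rewrite am mulr1 mul1r.
- apply: (mulrI (unitrX i (hD v0))); rewrite !mulrA -exprD subnKC ?(ltnW ik)//.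
  by rewrite !vka aik -mulrA -exprD subnKC ?(ltnW ik).
- by rewrite scale1r.
- by move=> u Hu; exact: comm1.
Qed.

End FiniteCenterContra.

(** * Almost subnormal series of the group of units *)

Section UnitsChain.
Variables (D : unitRingType) (hD : division_ring D).

Definition unit_image (S : set (units D)) : set D := (@unit_val D) @` S.

Lemma unit_val_inj : injective (@unit_val D).
Proof. exact: val_inj. Qed.

Lemma almost_subnormal_chain (N : set (units D)) : almost_subnormal N ->
  exists r H, subgroup_chain r H /\ H r = unit_image N.
Proof.
move=> [r [S [S0 Sr Sg Sstep]]]; exists r, (fun i => unit_image (S i)).
split; last by rewrite Sr.
have S1 i : (i <= r)%N -> S i 1%g by move=> /Sg[/set_mem].
have Sdiv i u v : (i <= r)%N -> S i u -> S i v -> S i (u * v^-1)%g.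
  by move=> /Sg[_ Sd] /mem_set Su /mem_set Sv; exact/set_mem/Sd.
have SV i v : (i <= r)%N -> S i v -> S i v^-1%g.
  by move=> ir Sv; rewrite -[v^-1%g]mul1g; apply: Sdiv => //; exact: S1.
split.
- by move=> x x0; rewrite S0; exists (Units (hD x0)).
- move=> i x ir [u _ <-]; apply/eqP => u0.
  by have := unit_valP u; rewrite u0 unitr0.
- move=> i _ _ ir [u Su <-] [v Sv <-].
  by exists (u * v^-1)%g => //; exact: Sdiv.
- by move=> i /Sstep[sub _] _ [u Su <-]; exists u => //; exact: sub.
move=> i ir; have [sub [[_ nrm]|[_ fin]]] := Sstep i ir; [left | right].
  move=> _ _ [u Su <-] [v Sv <-].
  exists (u ^ v^-1)%g.
    by apply: nrm => //; apply: SV => //; exact: ltnW.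
  by rewrite /conjg invgK /= mulrA.
have /finite_seqP[s sE] := fin.
(* The colour is the left coset of the inverse: with K for [S i.+1], u^-1 K = v^-1 K puts [u * v^-1]
   in K, whereas u K = v K would give u^-1 v. *)
pose C (x : D) := [set w : units D | exists2 u, unit_val u = x & exists2 y, S i.+1 y & w = (u^-1 * y)%g].
exists (size s).+1, (fun x => inord (index (C x) s)) => _ _ [u Su <-] [v Sv <-] e.
have CE w : C (unit_val w) = [set (w^-1 * y)%g | y in S i.+1].
  apply/seteqP; split=> [z [w' /unit_val_inj-> [y Sy ->]]|_ [y Sy <-]]; first by exists y.
  by exists w => //; exists y.
have Cs w : S i w -> C (unit_val w) \in s.
  move=> Sw; have : [set [set (x * y)%g | y in S i.+1] | x in S i] (C (unit_val w)).
    exists w^-1%g; last by rewrite CE.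
    by apply: SV => //; exact: ltnW.
  by rewrite sE.
have {e} Cuv : C (unit_val u) = C (unit_val v).
  have := congr1 val e; rewrite /= !inordK ?ltnS ?index_size// => e'.
  by rewrite -(nth_index set0 (Cs u Su)) e' nth_index ?Cs.
have : C (unit_val u) u^-1%g by exists u => //; exists 1%g; rewrite ?mulg1//; exact: S1.
rewrite Cuv CE => -[y Sy uy]; exists (y^-1)%g.
  exact: SV.
have -> : y = (v * u^-1)%g by rewrite -uy mulVKg.
by rewrite invgM invgK.
Qed.

End UnitsChain.

Theorem corollary1p6 (F : fieldType) (D : unitAlgType F) (N : set (units D))
    (hD : division_ring D) (hF : has_center D)
    (hsub : almost_subnormal N) (hab : ~ abelian_set N)
    (hdeg : exists d : nat, (0 < d)%N /\
       forall x y : units D, N x -> N y ->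
         exists n : nat, (n <= d)%N /\
           algebraic_of_degree (unit_val (x * y * x^-1 * y^-1)%g) n) :
  finite_dimensional D.
Proof.
apply: finite_rank_dimensional; apply: contrapT => infD.
have [r [H [hH HN]]] := almost_subnormal_chain hD hsub.
have [d [_ hd]] := hdeg.
have nc : exists x y, [/\ H r x, H r y & x * y <> y * x].
  apply: contrapT => nxy; apply: hab => x y Nx Ny; apply: contrapT => xy; apply: nxy.
  exists (unit_val x), (unit_val y); rewrite HN; split; [by exists x|by exists y|].
  by move=> h; apply: xy; apply: unit_val_inj.
have hdH x y : H r x -> H r y -> degree_le d (x * y * x^-1 * y^-1).
  rewrite HN => -[u Nu <-] [v Nv <-]; have [n [nd [p [pm pu _] sp]]] := hd u v Nu Nv.
  by exists p; rewrite sp ltnS; split=> //; exact: monic_neq0.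
have [finF|infF] := pselect (finite_set [set: F]).
  exact (finite_center_contra hD hF finF hH nc hdH).
exact (infinite_center_contra hD hF infD infF hH nc hdH).
Qed.
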